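(* Let $\mathcal C$ and $\mathcal D$ be GV-categories and let ${}_{\mathcal C}\mathcal M_{\mathcal D}$ be a GV-bimodule category. Then each of the $32$ pentagon diagrams for the distributors of $\mathcal M$ (one for each of the four positions of an object of $\mathcal M$ among four factors and each of the $2^3$ choices of operations $\Box_1,\Box_2,\Box_3\in\{\otimes,\odot\}$) commutes.
   Context: A GV-category is a monoidal category $(\mathcal C,\otimes,1)$ with a chosen dualizing object $K$: for every $y$ the functor $x\mapsto\mathrm{Hom}(x\otimes y,K)$ is represented by an object $Gy$, and the resulting contravariant functor $G$ is an anti-equivalence. The second tensor product is $x\odot y:=G^{-1}(Gy\otimes Gx)$, with unit $K$. A left GV-module category is a left module category $(\mathcal M,\triangleright)$ over $(\mathcal C,\otimes)$ such that all functors $c\triangleright{-}$ and ${-}\triangleright m$ have right adjoints; then $c\blacktriangleright{-}$, defined as a fixed right adjoint of $Gc\triangleright{-}$, is an action of $(\mathcal C,\odot)$. Right GV-module categories over $\mathcal D$ are defined analogously, with right actions $\triangleleft$ of $(\mathcal D,\otimes)$ and $\blacktriangleleft$ of $(\mathcal D,\odot)$, where ${-}\blacktriangleleft d$ is right adjoint to ${-}\triangleleft G^{-1}d$. A GV-bimodule category ${}_{\mathcal C}\mathcal M_{\mathcal D}$ is a bimodule category over $(\mathcal C,\otimes)$ and $(\mathcal D,\otimes)$ that is a left $\mathcal C$- and a right $\mathcal D$-GV-module category; it is then also a $(\mathcal C,\odot)$-$(\mathcal D,\odot)$-bimodule category via $\blacktriangleright,\blacktriangleleft$. Conjugation: if $(F,f^{\triangleright})$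 is a lax $\triangleright$-module functor between left GV-module categories, i.e. with coherent maps $f^{\triangleright}_{c,m}\colon c\triangleright F(m)\to F(c\triangleright m)$, then its conjugated oplax $\blacktriangleright$-module structure is $F(c\blacktriangleright m)\to c\blacktriangleright(Gc\triangleright F(c\blacktriangleright m))\to c\blacktriangleright F(Gc\triangleright(c\blacktriangleright m))\to c\blacktriangleright F(m)$ (unit of the adjunction, $f^{\triangleright}$, counit). This is a bijection between lax $\triangleright$- and oplax $\blacktriangleright$-module structures; analogously for right modules. Distributors of $\mathcal M$ (natural, not necessarily invertible), for $x,y,c\in\mathcal C$, $u,v,d\in\mathcal D$, $m\in\mathcal M$: left module distributors $(x\odot y)\triangleright m\to x\blacktriangleright(y\triangleright m)$ (the oplax $\blacktriangleright$-structure conjugated to the strong $\triangleright$-module structure of ${-}\triangleright m\colon\mathcal C\to\mathcal M$) and $x\triangleright(y\blacktriangleright m)\to(x\otimes y)\blacktriangleright m$ (the lax $\triangleright$-structure conjugated to the strong $\blacktriangleright$-module structure of ${-}\blacktriangleright m$); analogously the right module distributors $m\triangleleft(u\odot v)\to(m\triangleleft u)\blacktriangleleft v$ and $(m\blacktriangleleft u)\triangleleft v\to m\blacktriangleleft(u\otimes v)$; the bimodule distributor $c\triangleright(m\blacktriangleleft d)\to(c\triangleright m)\blacktriangleleft d$, which is the oplax $\blacktriangleleft$-structure conjugated to the strong $\triangleleft$-module structure of the functor $c\triangleright{-}\colon\mathcal M\to\mathcal M$; and the bimodule distributor $(c\blacktriangleright m)\triangleleft d\to c\blacktriangleright(m\triangleleft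 d)$, which is the lax $\triangleleft$-structure conjugated to the strong $\blacktriangleleft$-module structure of $c\blacktriangleright{-}$. The distributors of $\mathcal C$ and $\mathcal D$ themselves, $(x\odot y)\otimes z\to x\odot(y\otimes z)$ and $x\otimes(y\odot z)\to(x\otimes y)\odot z$, are the module distributors of the regular (bi)modules. Pentagons: consider four objects $a_1,a_2,a_3,a_4$, exactly one of which, $a_i$, lies in $\mathcal M$, with $a_j\in\mathcal C$ for $j<i$ and $a_j\in\mathcal D$ for $j>i$, and operations $\Box_1,\Box_2,\Box_3\in\{\otimes,\odot\}$, where $\otimes$ (resp. $\odot$) stands for the tensor product $\otimes$ (resp. $\odot$) or for the corresponding action $\triangleright,\triangleleft$ (resp. $\blacktriangleright,\blacktriangleleft$). The five bracketings of $a_1\Box_1a_2\Box_2a_3\Box_3a_4$ are the vertices of the pentagon. Each of its five edges relates $(p\,\Box\,q)\,\Box'\,r$ and $p\,\Box\,(q\,\Box'\,r)$ and is given by: the (invertible) associator or (bi)module constraint if $\Box=\Box'$; the distributor $(p\odot q)\otimes r\to p\odot(q\otimes r)$ if $\Box=\odot,\Box'=\otimes$; the distributor $p\otimes(q\odot r)\to(p\otimes q)\odot r$ if $\Box=\otimes,\Box'=\odot$. With invertible edges oriented suitably the pentagon consists of two composable paths with common source and target; commutativity means that the two composites are equal. For example, for $a_2\in\mathcal M$ and $(\Box_1,\Box_2,\Box_3)=(\otimes,\odot,\otimes)$ it says that the two composites $(c\triangleright(m\blacktriangleleft d))\triangleleft d'\to(c\triangleright m)\blacktriangleleft(d\otimes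 d')$ agree. *)

(* Defs.v *)
From Corelib Require Import ssreflect.

Set Implicit Arguments.
Unset Strict Implicit.
Unset Printing Implicit Defensive.

Declare Scope gv_scope.
Delimit Scope gv_scope with gv.
Open Scope gv_scope.

(* Morphisms are compared by Leibniz equality. *)
Record Category := {
  Obj :> Type;
  Hom : Obj -> Obj -> Type;
  idm : forall x, Hom x x;
  comp : forall x y z, Hom y z -> Hom x y -> Hom x z;
  comp1m : forall x y (f : Hom x y), comp (idm y) f = f;
  compm1 : forall x y (f : Hom x y), comp f (idm x) = f;
  compA : forall x y z w (h : Hom z w) (g : Hom y z) (f : Hom x y),
    comp h (comp g f) = comp (comp h g) f }.

Arguments Hom {c} _ _.
Arguments idm {c} x.
Arguments comp {c x y z} _ _.

Notation "g ∘ f" := (comp g f) (at level 40, left associativity) : gv_scope.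

Definition op (C : Category) : Category := {|
  Obj := Obj C;
  Hom := fun x y => @Hom C y x;
  idm := fun x => @idm C x;
  comp := fun x y z g f => @comp C z y x f g;
  comp1m := fun x y f => compm1 f;
  compm1 := fun x y f => comp1m f;
  compA := fun x y z w h g f => eq_sym (compA f g h) |}.

Record Bij (A B : Type) := {
  bto :> A -> B;
  bfrom : B -> A;
  bfromK : forall a, bfrom (bto a) = a;
  btoK : forall b, bto (bfrom b) = b }.

Definition bij_sym (A B : Type) (p : Bij A B) : Bij B A :=
  {| bto := bfrom p; bfrom := bto p; bfromK := btoK p; btoK := bfromK p |}.

Definition bij_trans (A B E : Type) (p : Bij A B) (q : Bij B E) : Bij A E.
Proof.
refine {| bto := fun a => q (p a); bfrom := fun e => bfrom p (bfrom q e) |}.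
- by move=> a; rewrite !bfromK.
- by move=> e; rewrite !btoK.
Defined.

Record Iso (C : Category) (x y : C) := {
  fwd : Hom x y;
  bwd : Hom y x;
  bwdK : bwd ∘ fwd = idm x;
  fwdK : fwd ∘ bwd = idm y }.

Definition iso_sym (C : Category) (x y : C) (i : Iso x y) : Iso y x :=
  {| fwd := bwd i; bwd := fwd i; bwdK := fwdK i; fwdK := bwdK i |}.

Definition iso_trans (C : Category) (x y z : C) (i : Iso x y) (j : Iso y z) :
  Iso x z.
Proof.
refine {| fwd := fwd j ∘ fwd i; bwd := bwd i ∘ bwd j |}.
- by rewrite compA -(compA (bwd i)) bwdK compm1 bwdK.
- by rewrite compA -(compA (fwd j)) fwdK compm1 fwdK.
Defined.

Definition bij_post (C : Category) (x y y' : C) (i : Iso y y') :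
  Bij (Hom x y) (Hom x y').
Proof.
refine {| bto := fun f => fwd i ∘ f; bfrom := fun f => bwd i ∘ f |}.
- by move=> f; rewrite compA bwdK comp1m.
- by move=> f; rewrite compA fwdK comp1m.
Defined.

Definition bij_pre (C : Category) (x x' y : C) (i : Iso x' x) :
  Bij (Hom x y) (Hom x' y).
Proof.
refine {| bto := fun f => f ∘ fwd i; bfrom := fun f => f ∘ bwd i |}.
- by move=> f; rewrite -compA fwdK compm1.
- by move=> f; rewrite -compA bwdK compm1.
Defined.

(* By the Yoneda lemma, a natural bijection of represented functors is
   induced by an isomorphism of the representing objects. *)
Definition yoneda_iso (C : Category) (a b : C)
  (p : forall x, Bij (Hom x a) (Hom x b))
  (p_nat : forall x x' (g : Hom x a) (f : Hom x' x), p x' (g ∘ f) = p x g ∘ f) :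
  Iso a b.
Proof.
refine {| fwd := p a (idm a); bwd := bfrom (p b) (idm b) |}.
- by rewrite -[RHS](bfromK (p a)) -[LHS](bfromK (p a)) p_nat btoK comp1m.
- by rewrite -p_nat comp1m btoK.
Defined.

Record Functor (A B : Category) := {
  fobj :> A -> B;
  fmap : forall x y, Hom x y -> Hom (fobj x) (fobj y);
  fmap1 : forall x, fmap (idm x) = idm (fobj x);
  fmapM : forall x y z (g : Hom y z) (f : Hom x y),
    fmap (g ∘ f) = fmap g ∘ fmap f }.

Arguments fmap {A B} _ {x y} _.

Definition fcomp (A B E : Category) (F : Functor B E) (F' : Functor A B) :
  Functor A E.
Proof.
refine {| fobj := fun a => F (F' a); fmap := fun x y f => fmap F (fmap F' f) |}.
- by move=> x; rewrite !fmap1.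
- by move=> x y z g f; rewrite !fmapM.
Defined.

Definition fmap_iso (A B : Category) (F : Functor A B) (x y : A)
  (i : Iso x y) : Iso (F x) (F y).
Proof.
refine {| fwd := fmap F (fwd i); bwd := fmap F (bwd i) |}.
- by rewrite -fmapM bwdK fmap1.
- by rewrite -fmapM fwdK fmap1.
Defined.

Record Bifunctor (A B E : Category) := {
  bobj :> A -> B -> E;
  bmap : forall a a' b b', Hom a a' -> Hom b b' -> Hom (bobj a b) (bobj a' b');
  bmap1 : forall a b, bmap (idm a) (idm b) = idm (bobj a b);
  bmapM : forall a a' a'' b b' b'' (g : Hom a' a'') (f : Hom a a')
                 (k : Hom b' b'') (h : Hom b b'),
    bmap (g ∘ f) (k ∘ h) = bmap g k ∘ bmap f h }.

Arguments bmap {A B E} _ {a a' b b'} _ _.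

(* bfun_l T a is T a -, and bfun_r T b is T - b. *)
Definition bfun_l (A B E : Category) (T : Bifunctor A B E) (a : A) :
  Functor B E.
Proof.
refine {| fobj := fun b => T a b; fmap := fun b b' h => bmap T (idm a) h |}.
- by move=> b; rewrite bmap1.
- by move=> b b' b'' k h; rewrite -bmapM comp1m.
Defined.

Definition bfun_r (A B E : Category) (T : Bifunctor A B E) (b : B) :
  Functor A E.
Proof.
refine {| fobj := fun a => T a b; fmap := fun a a' f => bmap T f (idm b) |}.
- by move=> a; rewrite bmap1.
- by move=> a a' a'' g f; rewrite -bmapM comp1m.
Defined.

Record NatIso (A B : Category) (F F' : Functor A B) := {
  niso :> forall a, Iso (F a) (F' a);
  niso_nat : forall a a' (f : Hom a a'),
    fwd (niso a') ∘ fmap F f = fmap F' f ∘ fwd (niso a) }.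

Lemma niso_nat_bwd (A B : Category) (F F' : Functor A B) (t : NatIso F F')
  (a a' : A) (f : Hom a a') : bwd (t a') ∘ fmap F' f = fmap F f ∘ bwd (t a).
Proof.
rewrite -[LHS]compm1 -(fwdK (t a)) compA -(compA _ _ (fwd _)) -niso_nat.
by rewrite compA bwdK comp1m.
Qed.

Definition niso_sym (A B : Category) (F F' : Functor A B) (t : NatIso F F') :
  NatIso F' F :=
  {| niso := fun a => iso_sym (t a); niso_nat := niso_nat_bwd t |}.

Record Adjunction (A B : Category) (L : Functor A B) (R : Functor B A) := {
  adj : forall a b, Bij (Hom (L a) b) (Hom a (R b));
  adj_natl : forall a a' b (g : Hom (L a) b) (f : Hom a' a),
    adj a' b (g ∘ fmap L f) = adj a b g ∘ f;
  adj_natr : forall a b b' (h : Hom b b') (g : Hom (L a) b),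
    adj a b' (h ∘ g) = fmap R h ∘ adj a b g }.

Arguments adj {A B L R} _ {a b}.

Definition unit_of (A B : Category) (L : Functor A B) (R : Functor B A)
  (ad : Adjunction L R) (a : A) : Hom a (R (L a)) := adj ad (idm (L a)).

Definition counit_of (A B : Category) (L : Functor A B) (R : Functor B A)
  (ad : Adjunction L R) (b : B) : Hom (L (R b)) b := bfrom (adj ad) (idm (R b)).

Record RightAdjoint (A B : Category) (L : Functor A B) := {
  radj :> Functor B A;
  radj_adj : Adjunction L radj }.

Lemma adjE (A B : Category) (L : Functor A B) (R : Functor B A)
  (ad : Adjunction L R) (a : A) (b : B) (g : Hom (L a) b) :
  adj ad g = fmap R g ∘ unit_of ad a.
Proof. by rewrite -adj_natr compm1. Qed.

Lemma adj_fromE (A B : Category) (L : Functor A B) (R : Functor B A)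
  (ad : Adjunction L R) (a : A) (b : B) (f : Hom a (R b)) :
  bfrom (adj ad) f = counit_of ad b ∘ fmap L f.
Proof.
rewrite -[RHS](bfromK (adj ad)) adj_natl btoK.
by rewrite comp1m.
Qed.

Lemma adj_from_natl (A B : Category) (L : Functor A B) (R : Functor B A)
  (ad : Adjunction L R) (a a' : A) (b : B) (g : Hom a (R b)) (f : Hom a' a) :
  bfrom (adj ad) (g ∘ f) = bfrom (adj ad) g ∘ fmap L f.
Proof. by rewrite !adj_fromE fmapM compA. Qed.

Lemma adj_from_natr (A B : Category) (L : Functor A B) (R : Functor B A)
  (ad : Adjunction L R) (a : A) (b b' : B) (h : Hom b b') (g : Hom a (R b)) :
  bfrom (adj ad) (fmap R h ∘ g) = h ∘ bfrom (adj ad) g.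
Proof. by rewrite -[RHS](bfromK (adj ad)) adj_natr btoK. Qed.

Definition adj_comp (A B E : Category) (L1 : Functor A B) (R1 : Functor B A)
  (L2 : Functor B E) (R2 : Functor E B)
  (ad1 : Adjunction L1 R1) (ad2 : Adjunction L2 R2) :
  Adjunction (fcomp L2 L1) (fcomp R1 R2).
Proof.
refine (@Build_Adjunction _ _ (fcomp L2 L1) (fcomp R1 R2)
  (fun a e => bij_trans (@adj _ _ _ _ ad2 (L1 a) e)
                        (@adj _ _ _ _ ad1 a (R2 e))) _ _).
- by move=> a a' b g f /=; rewrite !adj_natl.
- by move=> a b b' h g /=; rewrite !adj_natr.
Defined.

Definition adj_transfer (A B : Category) (L L' : Functor A B)
  (R : Functor B A) (t : NatIso L' L) (ad : Adjunction L R) : Adjunction L' R.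
Proof.
refine {| adj := fun a b =>
            bij_trans (bij_sym (bij_pre b (t a))) (@adj _ _ _ _ ad a b) |}.
- move=> a a' b g f /=.
  by rewrite -compA -niso_nat_bwd compA adj_natl.
- by move=> a b b' h g /=; rewrite -compA adj_natr.
Defined.

(* The mate R => R' of a transformation L' => L. *)
Definition conjugate (A B : Category) (L L' : Functor A B)
  (R R' : Functor B A) (ad : Adjunction L R) (ad' : Adjunction L' R')
  (t : forall a, Hom (L' a) (L a)) (b : B) : Hom (R b) (R' b) :=
  adj ad' (counit_of ad b ∘ t (R b)).

Definition conjugate_iso (A B : Category) (L L' : Functor A B)
  (R R' : Functor B A) (ad : Adjunction L R) (ad' : Adjunction L' R')
  (t : NatIso L' L) (b : B) : Iso (R b) (R' b).
Proof.
refine {| fwd := conjugate ad ad' (fun a => fwd (t a)) b;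
          bwd := conjugate ad' ad (fun a => bwd (t a)) b |}.
- rewrite /conjugate -adj_natl -compA niso_nat_bwd compA.
  rewrite -adj_fromE bfromK -compA fwdK compm1.
  by rewrite btoK.
- rewrite /conjugate -adj_natl -compA niso_nat compA.
  rewrite -adj_fromE bfromK -compA bwdK compm1.
  by rewrite btoK.
Defined.

(* The quasi-inverse is part of the data and chosen so that unit and counit
   satisfy the triangle identities. *)
Record AdjEquivalence (A B : Category) (F : Functor A B) := {
  einv :> Functor B A;
  eunit : forall a, Iso a (einv (F a));
  eunit_nat : forall a a' (f : Hom a a'),
    fwd (eunit a') ∘ f = fmap einv (fmap F f) ∘ fwd (eunit a);
  ecounit : forall b, Iso (F (einv b)) b;
  ecounit_nat : forall b b' (f : Hom b b'),
    fwd (ecounit b') ∘ fmap F (fmap einv f) = f ∘ fwd (ecounit b);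
  etriangle_l : forall a, fwd (ecounit (F a)) ∘ fmap F (fwd (eunit a)) = idm (F a);
  etriangle_r : forall b,
    fmap einv (fwd (ecounit b)) ∘ fwd (eunit (einv b)) = idm (einv b) }.

Record Monoidal := {
  mcat :> Category;
  tensor : Bifunctor mcat mcat mcat;
  munit : mcat;
  massoc : forall x y z, Iso (tensor (tensor x y) z) (tensor x (tensor y z));
  massoc_nat : forall x x' y y' z z'
      (f : Hom x x') (g : Hom y y') (h : Hom z z'),
    fwd (massoc x' y' z') ∘ bmap tensor (bmap tensor f g) h =
    bmap tensor f (bmap tensor g h) ∘ fwd (massoc x y z);
  mlunit : forall x, Iso (tensor munit x) x;
  mlunit_nat : forall x x' (f : Hom x x'),
    fwd (mlunit x') ∘ bmap tensor (idm munit) f = f ∘ fwd (mlunit x);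
  mrunit : forall x, Iso (tensor x munit) x;
  mrunit_nat : forall x x' (f : Hom x x'),
    fwd (mrunit x') ∘ bmap tensor f (idm munit) = f ∘ fwd (mrunit x);
  mpentagon : forall x y z w,
    bmap tensor (idm x) (fwd (massoc y z w)) ∘ fwd (massoc x (tensor y z) w)
      ∘ bmap tensor (fwd (massoc x y z)) (idm w) =
    fwd (massoc x y (tensor z w)) ∘ fwd (massoc (tensor x y) z w);
  mtriangle : forall x y,
    bmap tensor (idm x) (fwd (mlunit y)) ∘ fwd (massoc x munit y) =
    bmap tensor (fwd (mrunit x)) (idm y) }.

Notation "x ⊗ y" := (bobj (tensor _) x y) (at level 35, right associativity)
  : gv_scope.
Notation "f ⊗m g" := (bmap (tensor _) f g) (at level 35, right associativity)
  : gv_scope.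

(* For every y, the functor x |-> Hom (x ⊗ y) K is represented by dual_obj y. *)
Record Representation (C : Monoidal) (K : C) := {
  dual_obj : C -> C;
  rep : forall x y : C, Bij (Hom (x ⊗ y) K) (Hom x (dual_obj y));
  rep_nat : forall (x x' y : C) (h : Hom (x ⊗ y) K) (f : Hom x' x),
    rep x' y (h ∘ (f ⊗m idm y)) = rep x y h ∘ f }.

Arguments rep {C K} _ {x y}.

Lemma rep_from_nat (C : Monoidal) (K : C) (r : Representation K) (x x' y : C)
  (g : Hom x (dual_obj r y)) (f : Hom x' x) :
  bfrom (rep r) (g ∘ f) = bfrom (rep r) g ∘ (f ⊗m idm y).
Proof. by rewrite -[RHS](bfromK (rep r)) rep_nat btoK. Qed.

(* The contravariant functor G, with action on morphisms determined by
   naturality of the representing bijections in y. *)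
Definition dual_map (C : Monoidal) (K : C) (r : Representation K) (y y' : C)
  (f : Hom y y') : Hom (dual_obj r y') (dual_obj r y) :=
  rep r (bfrom (rep r) (idm (dual_obj r y')) ∘ (idm _ ⊗m f)).

Lemma rep_dual_map (C : Monoidal) (K : C) (r : Representation K) (x y y' : C)
  (h : Hom (x ⊗ y') K) (f : Hom y y') :
  rep r (h ∘ (idm x ⊗m f)) = dual_map r f ∘ rep r h.
Proof.
rewrite /dual_map -rep_nat -compA -bmapM comp1m compm1.
rewrite -{1}(bfromK (rep r) h) -{1}[rep r h]comp1m rep_from_nat.
by rewrite -compA -bmapM comp1m compm1.
Qed.

Definition dual_functor (C : Monoidal) (K : C) (r : Representation K) :
  Functor (op C) C.
Proof.
refine (@Build_Functor (op C) C (dual_obj r)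
          (fun y' y (f : @Hom C y y') => dual_map r f) _ _).
- by move=> y; rewrite /dual_map /= bmap1 compm1 btoK.
- move=> x y z g f /=.
  rewrite {1}/dual_map -{2}[idm (dual_obj r x)]comp1m bmapM compA.
  by rewrite !rep_dual_map btoK compm1.
Defined.

Record GVCategory := {
  gv_mon :> Monoidal;
  gvK : gv_mon;
  gv_rep : Representation gvK;
  gv_equiv : AdjEquivalence (dual_functor gv_rep) }.

Section GV.
Context (C : GVCategory).
Implicit Types x y z a b c d : C.

Definition G y : C := dual_functor (gv_rep C) y.
Definition Gmap y y' (f : Hom y y') : Hom (G y') (G y) :=
  @fmap (op C) C (dual_functor (gv_rep C)) y' y f.
Definition Ginv y : C := gv_equiv C y.
Definition Ginvmap y y' (f : Hom y y') : Hom (Ginv y') (Ginv y) :=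
  @fmap C (op C) (gv_equiv C) y y' f.

Lemma Gmap1 y : Gmap (idm y) = idm (G y).
Proof. exact: (@fmap1 (op C) C). Qed.
Lemma GmapM x y z (g : Hom y z) (f : Hom x y) :
  Gmap (g ∘ f) = Gmap f ∘ Gmap g.
Proof. exact: (@fmapM (op C) C (dual_functor (gv_rep C)) z y x f g). Qed.
Lemma Ginvmap1 y : Ginvmap (idm y) = idm (Ginv y).
Proof. exact: (@fmap1 C (op C)). Qed.
Lemma GinvmapM x y z (g : Hom y z) (f : Hom x y) :
  Ginvmap (g ∘ f) = Ginvmap f ∘ Ginvmap g.
Proof. exact: (@fmapM C (op C) (gv_equiv C)). Qed.

Definition Gmap_iso y y' (i : Iso y y') : Iso (G y') (G y).
Proof.
refine {| fwd := Gmap (fwd i); bwd := Gmap (bwd i) |}.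
- by rewrite -GmapM fwdK Gmap1.
- by rewrite -GmapM bwdK Gmap1.
Defined.

Definition Ginvmap_iso y y' (i : Iso y y') : Iso (Ginv y') (Ginv y).
Proof.
refine {| fwd := Ginvmap (fwd i); bwd := Ginvmap (bwd i) |}.
- by rewrite -GinvmapM fwdK Ginvmap1.
- by rewrite -GinvmapM bwdK Ginvmap1.
Defined.

Definition GGinv y : Iso (G (Ginv y)) y := ecounit (gv_equiv C) y.

(* The unit of the equivalence lives in the opposite category. *)
Definition GinvG y : Iso (Ginv (G y)) y :=
  let i : @Iso (op C) y (Ginv (G y)) := eunit (gv_equiv C) y in
  @Build_Iso C (Ginv (G y)) y (fwd i) (bwd i) (fwdK i) (bwdK i).

Lemma GGinv_nat y y' (f : Hom y y') :
  fwd (GGinv y') ∘ Gmap (Ginvmap f) = f ∘ fwd (GGinv y).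
Proof. exact: (ecounit_nat (gv_equiv C)). Qed.

Lemma GinvG_nat y y' (f : Hom y y') :
  f ∘ fwd (GinvG y) = fwd (GinvG y') ∘ Ginvmap (Gmap f).
Proof. exact: (@eunit_nat _ _ _ (gv_equiv C) y' y f). Qed.

Lemma GGinv_tri y : fwd (GGinv (G y)) ∘ Gmap (fwd (GinvG y)) = idm (G y).
Proof. exact: (etriangle_l (gv_equiv C) y). Qed.

Lemma GinvG_tri y : fwd (GinvG (Ginv y)) ∘ Ginvmap (fwd (GGinv y)) = idm (Ginv y).
Proof. exact: (etriangle_r (gv_equiv C) y). Qed.

Lemma GinvG_nat_bwd y y' (f : Hom y y') :
  Ginvmap (Gmap f) ∘ bwd (GinvG y) = bwd (GinvG y') ∘ f.
Proof.
rewrite -[RHS]compm1 -(fwdK (GinvG y)) compA -(compA _ f) GinvG_nat.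
by rewrite !compA bwdK comp1m.
Qed.

Lemma GGinv_nat_bwd y y' (f : Hom y y') :
  Gmap (Ginvmap f) ∘ bwd (GGinv y) = bwd (GGinv y') ∘ f.
Proof.
rewrite -[RHS]compm1 -(fwdK (GGinv y)) compA -(compA _ f) -GGinv_nat.
by rewrite !compA bwdK comp1m.
Qed.

Lemma GGinv_tri_bwd y : Gmap (bwd (GinvG y)) ∘ bwd (GGinv (G y)) = idm (G y).
Proof.
rewrite -[LHS]comp1m -{1}(GGinv_tri y) -compA (compA (Gmap (fwd _))) -GmapM bwdK.
by rewrite Gmap1 comp1m fwdK.
Qed.

Lemma GinvG_tri_bwd y :
  Ginvmap (bwd (GGinv y)) ∘ bwd (GinvG (Ginv y)) = idm (Ginv y).
Proof.
rewrite -[LHS]comp1m -{1}(GinvG_tri y) -compA (compA (Ginvmap (fwd _))) -GinvmapM.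
by rewrite bwdK Ginvmap1 comp1m fwdK.
Qed.

(* Hom (b ⊗ a) K = Hom b (G a) = Hom a (Ginv b) *)
Definition corep_fun a b (g : Hom b (G a)) : Hom a (Ginv b) :=
  Ginvmap g ∘ bwd (GinvG a).

Definition corep_bij a b : Bij (Hom b (G a)) (Hom a (Ginv b)).
Proof.
refine {| bto := @corep_fun a b;
          bfrom := fun f : Hom a (Ginv b) => Gmap f ∘ bwd (GGinv b) |}.
- move=> g; rewrite /corep_fun GmapM -compA GGinv_nat_bwd compA.
  by rewrite GGinv_tri_bwd comp1m.
- move=> f; rewrite /corep_fun GinvmapM -compA GinvG_nat_bwd compA.
  by rewrite GinvG_tri_bwd comp1m.
Defined.

Definition corep b a : Bij (Hom (b ⊗ a) (gvK C)) (Hom a (Ginv b)) :=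
  bij_trans (rep (gv_rep C)) (corep_bij a b).

Lemma corep_nat a a' b (h : Hom (b ⊗ a) (gvK C)) (f : Hom a' a) :
  corep b a' (h ∘ (idm b ⊗m f)) = corep b a h ∘ f.
Proof.
rewrite /= /corep_fun rep_dual_map GinvmapM -!compA; congr (_ ∘ _).
exact: GinvG_nat_bwd.
Qed.

Lemma corep_natr a b b' (h : Hom (b ⊗ a) (gvK C)) (f : Hom b' b) :
  corep b' a (h ∘ (f ⊗m idm a)) = Ginvmap f ∘ corep b a h.
Proof. by rewrite /= /corep_fun rep_nat GinvmapM !compA. Qed.

Lemma corep_from_nat a a' b (g : Hom a (Ginv b)) (f : Hom a' a) :
  bfrom (corep b a') (g ∘ f) = bfrom (corep b a) g ∘ (idm b ⊗m f).
Proof. by rewrite -[RHS](bfromK (corep b a')) corep_nat btoK. Qed.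

Lemma corep_from_natr a b b' (g : Hom a (Ginv b)) (f : Hom b' b) :
  bfrom (corep b' a) (Ginvmap f ∘ g) = bfrom (corep b a) g ∘ (f ⊗m idm a).
Proof. by rewrite -[RHS](bfromK (corep b' a)) corep_natr btoK. Qed.

Definition par_obj x y : C := Ginv (G y ⊗ G x).
Definition par_map x x' y y' (f : Hom x x') (g : Hom y y') :
  Hom (par_obj x y) (par_obj x' y') := Ginvmap (Gmap g ⊗m Gmap f).

Definition par : Bifunctor C C C.
Proof.
refine {| bobj := par_obj; bmap := par_map |}.
- by move=> x y; rewrite /par_map !Gmap1 bmap1 Ginvmap1.
- by move=> *; rewrite /par_map !GmapM bmapM GinvmapM.
Defined.

Definition Gpar x y : Iso (G (par x y)) (G y ⊗ G x) := GGinv (G y ⊗ G x).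

(* G^-1 (G z ⊗ G (x ⊙ y)) = G^-1 (G z ⊗ (G y ⊗ G x)) = G^-1 ((G z ⊗ G y) ⊗ G x)
   = G^-1 (G (y ⊙ z) ⊗ G x) *)
Definition par_assoc x y z : Iso (par (par x y) z) (par x (par y z)) :=
  iso_trans (Ginvmap_iso (iso_sym (fmap_iso (bfun_l (tensor C) (G z)) (Gpar x y))))
 (iso_trans (Ginvmap_iso (massoc (G z) (G y) (G x)))
            (Ginvmap_iso (fmap_iso (bfun_r (tensor C) (G x)) (Gpar y z)))).

(* Hom a z = Hom (G z ⊗ a) K *)
Definition form a z : Bij (Hom a z) (Hom (G z ⊗ a) (gvK C)) :=
  bij_trans (bij_post a (iso_sym (GinvG z))) (bij_sym (corep (G z) a)).

Lemma form_natl a a' z (g : Hom a z) (f : Hom a' a) :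
  form a' z (g ∘ f) = form a z g ∘ (idm _ ⊗m f).
Proof. by rewrite [LHS]/= [in RHS]/= compA; exact: corep_from_nat. Qed.

Lemma form_natr a z z' (h : Hom z z') (g : Hom a z) :
  form a z' (h ∘ g) = form a z g ∘ (Gmap h ⊗m idm a).
Proof.
have E : bwd (GinvG z') ∘ (h ∘ g) = Ginvmap (Gmap h) ∘ (bwd (GinvG z) ∘ g).
  by rewrite !compA GinvG_nat_bwd.
have -> : form a z' (h ∘ g) = bfrom (corep (G z') a) (bwd (GinvG z') ∘ (h ∘ g)).
  by [].
by rewrite E corep_from_natr.
Qed.

(* Hom (G c ⊗ x) z = Hom (G z ⊗ G c ⊗ x) K = Hom x (c ⊙ z) *)
Definition lcur c x z : Bij (Hom (G c ⊗ x) z) (Hom x (par c z)) :=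
  bij_trans (form (G c ⊗ x) z)
 (bij_trans (bij_pre _ (massoc (G z) (G c) x)) (corep (G z ⊗ G c) x)).

Lemma lcurE c x z (g : Hom (G c ⊗ x) z) :
  lcur c x z g =
  corep (G z ⊗ G c) x (form (G c ⊗ x) z g ∘ fwd (massoc (G z) (G c) x)).
Proof. by []. Qed.

Lemma lcur_natl c x x' z (g : Hom (G c ⊗ x) z) (f : Hom x' x) :
  lcur c x' z (g ∘ (idm _ ⊗m f)) = lcur c x z g ∘ f.
Proof.
by rewrite !lcurE form_natl -compA -massoc_nat bmap1 compA corep_nat.
Qed.

Lemma lcur_natr c x z z' (h : Hom z z') (g : Hom (G c ⊗ x) z) :
  lcur c x z' (h ∘ g) = bmap par (idm c) h ∘ lcur c x z g.
Proof.
rewrite !lcurE form_natr -compA -(bmap1 (tensor C)) -massoc_nat compA corep_natr.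
by rewrite /= /par_map Gmap1.
Qed.

Lemma lcur_natc c c' x z (f : Hom c c') (g : Hom (G c ⊗ x) z) :
  lcur c' x z (g ∘ (Gmap f ⊗m idm x)) = bmap par f (idm z) ∘ lcur c x z g.
Proof.
rewrite !lcurE form_natl -compA -massoc_nat compA corep_natr.
by rewrite /= /par_map Gmap1.
Qed.

Definition ladj c : Adjunction (bfun_l (tensor C) (G c)) (bfun_l par c) :=
  @Build_Adjunction _ _ (bfun_l (tensor C) (G c)) (bfun_l par c)
    (fun x z => lcur c x z)
    (fun x x' z g f => lcur_natl g f) (fun x z z' h g => lcur_natr h g).

(* Hom (x ⊗ Ginv d) z = Hom ((G z ⊗ x) ⊗ Ginv d) K = Hom (G z ⊗ x) d
   = Hom x (z ⊙ d) *)
Definition rcur d x z : Bij (Hom (x ⊗ Ginv d) z) (Hom x (par z d)) :=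
  bij_trans (form (x ⊗ Ginv d) z)
 (bij_trans (bij_pre _ (massoc (G z) x (Ginv d)))
 (bij_trans (rep (gv_rep C))
 (bij_trans (bij_post _ (GGinv d)) (lcur z x d)))).

Lemma rcurE d x z (g : Hom (x ⊗ Ginv d) z) :
  rcur d x z g =
  lcur z x d (fwd (GGinv d) ∘ rep (gv_rep C)
    (form (x ⊗ Ginv d) z g ∘ fwd (massoc (G z) x (Ginv d)))).
Proof. by []. Qed.

Lemma rcur_natl d x x' z (g : Hom (x ⊗ Ginv d) z) (f : Hom x' x) :
  rcur d x' z (g ∘ (f ⊗m idm _)) = rcur d x z g ∘ f.
Proof.
by rewrite !rcurE form_natl -compA -massoc_nat compA rep_nat compA lcur_natl.
Qed.

Lemma rcur_natr d x z z' (h : Hom z z') (g : Hom (x ⊗ Ginv d) z) :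
  rcur d x z' (h ∘ g) = bmap par h (idm d) ∘ rcur d x z g.
Proof.
rewrite !rcurE form_natr -compA -(bmap1 (tensor C)) -massoc_nat compA rep_nat.
by rewrite compA lcur_natc.
Qed.

Definition radj_par d : Adjunction (bfun_r (tensor C) (Ginv d)) (bfun_r par d) :=
  @Build_Adjunction _ _ (bfun_r (tensor C) (Ginv d)) (bfun_r par d)
    (fun x z => rcur d x z)
    (fun x x' z g f => rcur_natl g f) (fun x z z' h g => rcur_natr h g).

(* Hom x (G (Ginv v ⊗ Ginv u)) = Hom ((x ⊗ Ginv v) ⊗ Ginv u) K
   = Hom (x ⊗ Ginv v) u = Hom x (u ⊙ v) *)
Definition par_G_bij u v x : Bij (Hom x (G (Ginv v ⊗ Ginv u))) (Hom x (par u v)) :=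
  bij_trans (bij_sym (rep (gv_rep C)))
 (bij_trans (bij_pre _ (massoc x (Ginv v) (Ginv u)))
 (bij_trans (rep (gv_rep C))
 (bij_trans (bij_post _ (GGinv u)) (rcur v x u)))).

Lemma par_G_bij_nat u v x x' (g : Hom x (G (Ginv v ⊗ Ginv u))) (f : Hom x' x) :
  par_G_bij u v x' (g ∘ f) = par_G_bij u v x g ∘ f.
Proof.
have E y (k : Hom y (G (Ginv v ⊗ Ginv u))) : par_G_bij u v y k =
    rcur v y u (fwd (GGinv u) ∘ rep (gv_rep C)
      (bfrom (rep (gv_rep C)) k ∘ fwd (massoc y (Ginv v) (Ginv u)))) by [].
rewrite !E rep_from_nat -(bmap1 (tensor C)) -compA -massoc_nat compA rep_nat.
by rewrite compA rcur_natl.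
Qed.

Definition par_G u v : Iso (G (Ginv v ⊗ Ginv u)) (par u v) :=
  yoneda_iso (@par_G_bij_nat u v).

Definition Ginvpar u v : Iso (Ginv (par u v)) (Ginv v ⊗ Ginv u) :=
  iso_trans (Ginvmap_iso (par_G u v)) (GinvG (Ginv v ⊗ Ginv u)).

End GV.

Arguments par {C}.
Notation "x ⊙ y" := (bobj par x y) (at level 35, right associativity)
  : gv_scope.

Record LeftModule (C : Monoidal) (M : Category) := {
  lact : Bifunctor C M M;
  lassoc : forall (x y : C) m, Iso (lact (x ⊗ y) m) (lact x (lact y m));
  lassoc_nat : forall (x x' y y' : C) m m'
      (f : Hom x x') (g : Hom y y') (h : Hom m m'),
    fwd (lassoc x' y' m') ∘ bmap lact (f ⊗m g) h =
    bmap lact f (bmap lact g h) ∘ fwd (lassoc x y m);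
  lunit : forall m, Iso (lact (munit C) m) m;
  lunit_nat : forall m m' (h : Hom m m'),
    fwd (lunit m') ∘ bmap lact (idm _) h = h ∘ fwd (lunit m);
  lpentagon : forall x y z m,
    bmap lact (idm x) (fwd (lassoc y z m)) ∘ fwd (lassoc x (y ⊗ z) m)
      ∘ bmap lact (fwd (massoc x y z)) (idm m) =
    fwd (lassoc x y (lact z m)) ∘ fwd (lassoc (x ⊗ y) z m);
  ltriangle : forall x m,
    bmap lact (idm x) (fwd (lunit m)) ∘ fwd (lassoc x (munit C) m) =
    bmap lact (fwd (mrunit x)) (idm m) }.

Record RightModule (D : Monoidal) (M : Category) := {
  ract : Bifunctor M D M;
  rassoc : forall m (u v : D), Iso (ract (ract m u) v) (ract m (u ⊗ v));
  rassoc_nat : forall m m' (u u' v v' : D)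
      (h : Hom m m') (f : Hom u u') (g : Hom v v'),
    fwd (rassoc m' u' v') ∘ bmap ract (bmap ract h f) g =
    bmap ract h (f ⊗m g) ∘ fwd (rassoc m u v);
  runit : forall m, Iso (ract m (munit D)) m;
  runit_nat : forall m m' (h : Hom m m'),
    fwd (runit m') ∘ bmap ract h (idm _) = h ∘ fwd (runit m);
  rpentagon : forall m u v w,
    bmap ract (idm m) (fwd (massoc u v w)) ∘ fwd (rassoc m (u ⊗ v) w)
      ∘ bmap ract (fwd (rassoc m u v)) (idm w) =
    fwd (rassoc m u (v ⊗ w)) ∘ fwd (rassoc (ract m u) v w);
  rtriangle : forall m u,
    bmap ract (idm m) (fwd (mlunit u)) ∘ fwd (rassoc m (munit D) u) =
    bmap ract (fwd (runit m)) (idm u) }.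

Record Bimodule (C D : Monoidal) (M : Category) := {
  bimod_l : LeftModule C M;
  bimod_r : RightModule D M;
  bassoc : forall (c : C) m (d : D),
    Iso (ract bimod_r (lact bimod_l c m) d) (lact bimod_l c (ract bimod_r m d));
  bassoc_nat : forall (c c' : C) m m' (d d' : D)
      (f : Hom c c') (h : Hom m m') (g : Hom d d'),
    fwd (bassoc c' m' d') ∘ bmap (ract bimod_r) (bmap (lact bimod_l) f h) g =
    bmap (lact bimod_l) f (bmap (ract bimod_r) h g) ∘ fwd (bassoc c m d);
  bpentagon_l : forall (x y : C) m (d : D),
    bmap (lact bimod_l) (idm x) (fwd (bassoc y m d))
      ∘ fwd (bassoc x (lact bimod_l y m) d)
      ∘ bmap (ract bimod_r) (fwd (lassoc bimod_l x y m)) (idm d) =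
    fwd (lassoc bimod_l x y (ract bimod_r m d)) ∘ fwd (bassoc (x ⊗ y) m d);
  bpentagon_r : forall (c : C) m (u v : D),
    bmap (lact bimod_l) (idm c) (fwd (rassoc bimod_r m u v))
      ∘ fwd (bassoc c (ract bimod_r m u) v)
      ∘ bmap (ract bimod_r) (fwd (bassoc c m u)) (idm v) =
    fwd (bassoc c m (u ⊗ v)) ∘ fwd (rassoc bimod_r (lact bimod_l c m) u v) }.

(* Below, ▷ and ◁ stand for lact and ract. lgv c is the functor c ▶ -,
   a fixed right adjoint of G c ▷ -. *)
Record LeftGV (C : GVCategory) (M : Category) (V : LeftModule C M) := {
  lgv_act : forall c : C, inhabited (RightAdjoint (bfun_l (lact V) c));
  lgv_obj : forall m : M, inhabited (RightAdjoint (bfun_r (lact V) m));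
  lgv : forall c : C, RightAdjoint (bfun_l (lact V) (G c)) }.

(* rgv d is the functor - ◀ d, a fixed right adjoint of - ◁ Ginv d. *)
Record RightGV (D : GVCategory) (M : Category) (V : RightModule D M) := {
  rgv_act : forall d : D, inhabited (RightAdjoint (bfun_r (ract V) d));
  rgv_obj : forall m : M, inhabited (RightAdjoint (bfun_l (ract V) m));
  rgv : forall d : D, RightAdjoint (bfun_r (ract V) (Ginv d)) }.

Lemma conjugate_id (A B : Category) (L : Functor A B) (R : Functor B A)
  (ad : Adjunction L R) (b : B) :
  conjugate ad ad (fun a => idm (L a)) b = idm (R b).
Proof. by rewrite /conjugate compm1 btoK. Qed.

Lemma conjugate_nat (A B : Category) (L L' : Functor A B)
  (R R' : Functor B A) (ad : Adjunction L R) (ad' : Adjunction L' R')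
  (t : forall a, Hom (L' a) (L a))
  (t_nat : forall a a' (f : Hom a a'), t a' ∘ fmap L' f = fmap L f ∘ t a)
  (b b' : B) (h : Hom b b') :
  conjugate ad ad' t b' ∘ fmap R h = fmap R' h ∘ conjugate ad ad' t b.
Proof.
rewrite /conjugate -adj_natl -adj_natr; congr (adj ad' _).
rewrite -compA t_nat !compA; congr (_ ∘ _).
by rewrite -adj_fromE -[fmap R h]compm1 adj_from_natr.
Qed.

Lemma conjugate_comp (A B : Category) (L L' L'' : Functor A B)
  (R R' R'' : Functor B A) (ad : Adjunction L R) (ad' : Adjunction L' R')
  (ad'' : Adjunction L'' R'')
  (t : forall a, Hom (L' a) (L a)) (s : forall a, Hom (L'' a) (L' a))
  (s_nat : forall a a' (f : Hom a a'), s a' ∘ fmap L'' f = fmap L' f ∘ s a)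
  (b : B) :
  conjugate ad' ad'' s b ∘ conjugate ad ad' t b =
  conjugate ad ad'' (fun a => t a ∘ s a) b.
Proof.
rewrite {1}/conjugate -adj_natl -compA s_nat compA -adj_fromE bfromK.
by rewrite /conjugate -compA.
Qed.

Lemma bmap_swap (A B E : Category) (T : Bifunctor A B E) (a a' : A) (b b' : B)
  (f : Hom a a') (h : Hom b b') :
  bmap T f (idm b') ∘ bmap T (idm a) h = bmap T (idm a') h ∘ bmap T f (idm b).
Proof. by rewrite -!bmapM !comp1m !compm1. Qed.

(* For L -| R on A, L' -| R' on B and a functor F : A -> B: the bijection
   between transformations L' F => F L and F R => R' F. *)
Section Mate.
Context (A B : Category) (F : Functor A B).
Context (L R : Functor A A) (L' R' : Functor B B).
Context (ad : Adjunction L R) (ad' : Adjunction L' R').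

Definition mate (f : forall m, Hom (L' (F m)) (F (L m))) (m : A) :
  Hom (F (R m)) (R' (F m)) :=
  fmap R' (fmap F (counit_of ad m)) ∘ fmap R' (f (R m)) ∘ unit_of ad' (F (R m)).

Definition unmate (g : forall m, Hom (F (R m)) (R' (F m))) (m : A) :
  Hom (L' (F m)) (F (L m)) :=
  counit_of ad' (F (L m)) ∘ fmap L' (g (L m)) ∘ fmap L' (fmap F (unit_of ad m)).

Lemma mateE f m :
  mate f m = adj ad' (fmap F (counit_of ad m) ∘ f (R m)).
Proof. by rewrite adjE fmapM. Qed.

Lemma unmateE g m :
  unmate g m = bfrom (adj ad') (g (L m) ∘ fmap F (unit_of ad m)).
Proof. by rewrite adj_fromE fmapM compA. Qed.

Lemma mateK (f : forall m, Hom (L' (F m)) (F (L m)))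
  (f_nat : forall m m' (h : Hom m m'),
    f m' ∘ fmap L' (fmap F h) = fmap F (fmap L h) ∘ f m) (m : A) :
  unmate (mate f) m = f m.
Proof.
rewrite unmateE mateE adj_from_natl bfromK -compA f_nat compA -fmapM.
by rewrite -adj_fromE bfromK fmap1 comp1m.
Qed.

Lemma unmateK (g : forall m, Hom (F (R m)) (R' (F m)))
  (g_nat : forall m m' (h : Hom m m'),
    g m' ∘ fmap F (fmap R h) = fmap R' (fmap F h) ∘ g m) (m : A) :
  mate (unmate g) m = g m.
Proof.
rewrite mateE unmateE adj_natr btoK compA -g_nat -compA -fmapM.
by rewrite -adjE btoK fmap1 compm1.
Qed.

End Mate.

Lemma mate_ext (A B : Category) (F : Functor A B) (L R : Functor A A)
  (L' R' : Functor B B) (ad : Adjunction L R) (ad' : Adjunction L' R')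
  (f f' : forall m, Hom (L' (F m)) (F (L m))) (m : A) :
  f (R m) = f' (R m) -> mate ad ad' f m = mate ad ad' f' m.
Proof. by rewrite /mate => ->. Qed.

Lemma unmate_nat (A B : Category) (F : Functor A B)
  (L R L1 R1 : Functor A A) (L' R' L1' R1' : Functor B B)
  (ad : Adjunction L R) (ad1 : Adjunction L1 R1)
  (ad' : Adjunction L' R') (ad1' : Adjunction L1' R1')
  (t : forall a, Hom (L1 a) (L a)) (t' : forall b, Hom (L1' b) (L' b))
  (g : forall m, Hom (F (R m)) (R' (F m)))
  (g1 : forall m, Hom (F (R1 m)) (R1' (F m)))
  (t_nat : forall a a' (f : Hom a a'), t a' ∘ fmap L1 f = fmap L f ∘ t a)
  (t'_nat : forall a a' (f : Hom a a'), t' a' ∘ fmap L1' f = fmap L' f ∘ t' a)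
  (g1_nat : forall m m' (h : Hom m m'),
    g1 m' ∘ fmap F (fmap R1 h) = fmap R1' (fmap F h) ∘ g1 m)
  (gg1 : forall m, g1 m ∘ fmap F (conjugate ad ad1 t m) =
                   conjugate ad' ad1' t' (F m) ∘ g m) (m : A) :
  fmap F (t m) ∘ unmate ad1 ad1' g1 m = unmate ad ad' g m ∘ t' (F m).
Proof.
rewrite !unmateE -[LHS](bfromK (adj ad1')) -[RHS](bfromK (adj ad1')).
congr (bfrom _ _); rewrite adj_natr btoK compA -g1_nat -compA -fmapM.
have -> : fmap R1 (t m) ∘ unit_of ad1 m = conjugate ad ad1 t (L m) ∘ unit_of ad m.
  rewrite -adjE /conjugate -adj_natl -compA t_nat compA -adj_fromE bfromK.
  by rewrite comp1m.
rewrite fmapM compA gg1 /conjugate -compA -adj_natl -compA t'_nat compA.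
by rewrite -adj_fromE.
Qed.

Section LeftModuleFunctors.
Context (C : GVCategory) (M : Category) (V : LeftModule C M) (gV : LeftGV V).

(* A morphism c -> c' acts by the mate of G c' ▷ - => G c ▷ -. *)
Definition lpar_map (c c' : C) (m m' : M) (f : Hom c c') (h : Hom m m') :
  Hom (lgv gV c m) (lgv gV c' m') :=
  conjugate (radj_adj (lgv gV c)) (radj_adj (lgv gV c'))
    (fun n => bmap (lact V) (Gmap f) (idm n)) m' ∘ fmap (lgv gV c) h.

Definition lpar : Bifunctor C M M.
Proof.
refine (@Build_Bifunctor C M M (fun c m => lgv gV c m) lpar_map _ _).
- move=> c m; rewrite /lpar_map fmap1 compm1 Gmap1.
  rewrite -[RHS](conjugate_id (radj_adj (lgv gV c))) /conjugate /=.
  by rewrite bmap1.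
- move=> c c' c'' m m' m'' g f k h; rewrite /lpar_map fmapM.
  rewrite -[RHS]compA [in RHS](compA (fmap _ k)) -conjugate_nat.
    by move=> *; exact: bmap_swap.
  rewrite !compA; congr (_ ∘ _); congr (_ ∘ _).
  rewrite conjugate_comp; first by move=> *; exact: bmap_swap.
  by rewrite /conjugate GmapM -bmapM comp1m.
Defined.

(* G y ▷ (G x ▷ -) = G (x ⊙ y) ▷ -, of which x ▶ (y ▶ -) and (x ⊙ y) ▶ - are
   right adjoints *)
Definition lpar_niso (x y : C) :
  NatIso (fcomp (bfun_l (lact V) (G y)) (bfun_l (lact V) (G x)))
         (bfun_l (lact V) (G (x ⊙ y))).
Proof.
refine {| niso := fun m : M =>
  iso_trans (iso_sym (lassoc V (G y) (G x) m))
            (fmap_iso (bfun_r (lact V) m) (iso_sym (Gpar x y)))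
  : Iso (fcomp (bfun_l (lact V) (G y)) (bfun_l (lact V) (G x)) m)
        (bfun_l (lact V) (G (x ⊙ y)) m) |}.
move=> m m' f /=.
rewrite -[LHS]compA -[bmap (lact V) (idm (G y)) _]compm1.
rewrite -{1}(fwdK (lassoc V (G y) (G x) m)).
rewrite [_ ∘ (fwd _ ∘ bwd _)]compA -lassoc_nat [bwd _ ∘ _]compA [bwd _ ∘ _]compA.
by rewrite bwdK comp1m bmap1 !compA bmap_swap.
Defined.

Definition lpar_assoc (x y : C) (m : M) :
  Iso (lpar (x ⊙ y) m) (lpar x (lpar y m)) :=
  conjugate_iso (radj_adj (lgv gV (x ⊙ y)))
    (adj_comp (radj_adj (lgv gV x)) (radj_adj (lgv gV y))) (lpar_niso x y) m.

End LeftModuleFunctors.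

Section LeftConjugation.
Context (C : GVCategory) (M N : Category) (V : LeftModule C M) (W : LeftModule C N).
Context (gV : LeftGV V) (gW : LeftGV W) (F : Functor M N).

Definition lconj (f : forall (c : C) (m : M), Hom (lact W c (F m)) (F (lact V c m)))
  (c : C) (m : M) : Hom (F (lpar gV c m)) (lpar gW c (F m)) :=
  mate (radj_adj (lgv gV c)) (radj_adj (lgv gW c)) (f (G c)) m.

(* The inverse of lconj: c is identified with G (Ginv c). *)
Definition lconj_inv
  (g : forall (c : C) (m : M), Hom (F (lpar gV c m)) (lpar gW c (F m)))
  (c : C) (m : M) : Hom (lact W c (F m)) (F (lact V c m)) :=
  fmap F (bmap (lact V) (fwd (GGinv c)) (idm m))
    ∘ unmate (radj_adj (lgv gV (Ginv c))) (radj_adj (lgv gW (Ginv c))) (g (Ginv c)) m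
    ∘ bmap (lact W) (bwd (GGinv c)) (idm (F m)).

Lemma lconjK (f : forall (c : C) (m : M), Hom (lact W c (F m)) (F (lact V c m)))
  (f_nat : forall c c' m m' (k : Hom c c') (h : Hom m m'),
    f c' m' ∘ bmap (lact W) k (fmap F h) = fmap F (bmap (lact V) k h) ∘ f c m)
  (c : C) (m : M) : lconj_inv (lconj f) c m = f c m.
Proof.
rewrite /lconj_inv /lconj mateK; first by move=> *; exact: f_nat.
rewrite -f_nat -compA -bmapM fwdK fmap1 comp1m.
by rewrite bmap1 compm1.
Qed.

Lemma lconj_invK
  (g : forall (c : C) (m : M), Hom (F (lpar gV c m)) (lpar gW c (F m)))
  (g_nat : forall c c' m m' (k : Hom c c') (h : Hom m m'),
    g c' m' ∘ fmap F (bmap (lpar gV) k h) = bmap (lpar gW) k (fmap F h) ∘ g c m)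
  (c : C) (m : M) : lconj (lconj_inv g) c m = g c m.
Proof.
have g_natm a n n' (h : Hom n n') :
    g a n' ∘ fmap F (fmap (lgv gV a) h) = fmap (lgv gW a) (fmap F h) ∘ g a n.
  have := g_nat a a n n' (idm a) h.
  have bE X (U : LeftModule C X) (gU : LeftGV U) p q (l : Hom p q) :
      bmap (lpar gU) (idm a) l = fmap (lgv gU a) l.
    rewrite -[RHS]comp1m -(conjugate_id (radj_adj (lgv gU a))) /conjugate /=.
    by rewrite /lpar_map /conjugate Gmap1 bmap1.
  by rewrite !bE.
rewrite -[RHS](unmateK (radj_adj (lgv gV c)) (radj_adj (lgv gW c)) (g_natm c)).
apply: mate_ext; rewrite /lconj_inv.
have E : bwd (GGinv (G c)) = Gmap (fwd (GinvG c)).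
  rewrite -[RHS]comp1m -(bwdK (GGinv (G c))) -compA GGinv_tri.
  by rewrite compm1.
rewrite E -[LHS]compA -(unmate_nat (F := F)
  (ad := radj_adj (lgv gV (Ginv (G c)))) (ad1 := radj_adj (lgv gV c))
  (ad' := radj_adj (lgv gW (Ginv (G c)))) (ad1' := radj_adj (lgv gW c))
  (t := fun n => bmap (lact V) (Gmap (fwd (GinvG c))) (idm n))
  (t' := fun n => bmap (lact W) (Gmap (fwd (GinvG c))) (idm n))
  (g := g (Ginv (G c))) (g1 := g c)).
- by move=> *; exact: bmap_swap.
- by move=> *; exact: bmap_swap.
- exact: g_natm.
- move=> n; have := g_nat _ _ n n (fwd (GinvG c)) (idm n).
  by rewrite /= /lpar_map !fmap1 !compm1.
- rewrite compA -fmapM -bmapM GGinv_tri comp1m.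
  by rewrite bmap1 fmap1 comp1m.
Qed.

End LeftConjugation.

Section RightModuleFunctors.
Context (D : GVCategory) (M : Category) (V : RightModule D M) (gV : RightGV V).

Definition rpar_map (m m' : M) (d d' : D) (h : Hom m m') (f : Hom d d') :
  Hom (rgv gV d m) (rgv gV d' m') :=
  conjugate (radj_adj (rgv gV d)) (radj_adj (rgv gV d'))
    (fun n => bmap (ract V) (idm n) (Ginvmap f)) m' ∘ fmap (rgv gV d) h.

Definition rpar : Bifunctor M D M.
Proof.
refine (@Build_Bifunctor M D M (fun m d => rgv gV d m) rpar_map _ _).
- move=> m d; rewrite /rpar_map fmap1 compm1 Ginvmap1.
  rewrite -[RHS](conjugate_id (radj_adj (rgv gV d))) /conjugate /=.
  by rewrite bmap1.
- move=> m m' m'' d d' d'' k h g f; rewrite /rpar_map fmapM.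
  rewrite -[RHS]compA [in RHS](compA (fmap _ k)) -conjugate_nat.
    by move=> *; symmetry; exact: bmap_swap.
  rewrite !compA; congr (_ ∘ _); congr (_ ∘ _).
  rewrite conjugate_comp; first by move=> *; symmetry; exact: bmap_swap.
  by rewrite /conjugate GinvmapM -bmapM comp1m.
Defined.

(* - ◁ Ginv (u ⊙ v) = (- ◁ Ginv v) ◁ Ginv u, of which - ◀ (u ⊙ v) and
   (- ◀ u) ◀ v are right adjoints *)
Definition rpar_niso (u v : D) :
  NatIso (bfun_r (ract V) (Ginv (u ⊙ v)))
         (fcomp (bfun_r (ract V) (Ginv u)) (bfun_r (ract V) (Ginv v))).
Proof.
refine {| niso := fun m : M =>
  iso_trans (fmap_iso (bfun_l (ract V) m) (Ginvpar u v))
            (iso_sym (rassoc V m (Ginv v) (Ginv u)))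
  : Iso (bfun_r (ract V) (Ginv (u ⊙ v)) m)
        (fcomp (bfun_r (ract V) (Ginv u)) (bfun_r (ract V) (Ginv v)) m) |}.
move=> m m' f /=.
rewrite -[LHS]compA -bmap_swap compA [RHS]compA; congr (_ ∘ _).
rewrite -[LHS]compm1 -(fwdK (rassoc V m (Ginv v) (Ginv u))).
rewrite [LHS]compA -(compA (bwd _)) -(bmap1 (tensor D)) -rassoc_nat compA.
by rewrite bwdK comp1m.
Defined.

Definition rpar_assoc (m : M) (u v : D) :
  Iso (rpar (rpar m u) v) (rpar m (u ⊙ v)) :=
  conjugate_iso (adj_comp (radj_adj (rgv gV v)) (radj_adj (rgv gV u)))
    (radj_adj (rgv gV (u ⊙ v))) (rpar_niso u v) m.

End RightModuleFunctors.

Section RightConjugation.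
Context (D : GVCategory) (M N : Category) (V : RightModule D M) (W : RightModule D N).
Context (gV : RightGV V) (gW : RightGV W) (F : Functor M N).

Definition rconj (f : forall (m : M) (d : D), Hom (ract W (F m) d) (F (ract V m d)))
  (m : M) (d : D) : Hom (F (rpar gV m d)) (rpar gW (F m) d) :=
  mate (radj_adj (rgv gV d)) (radj_adj (rgv gW d)) (fun n => f n (Ginv d)) m.

(* The inverse of rconj: d is identified with Ginv (G d). *)
Definition rconj_inv
  (g : forall (m : M) (d : D), Hom (F (rpar gV m d)) (rpar gW (F m) d))
  (m : M) (d : D) : Hom (ract W (F m) d) (F (ract V m d)) :=
  fmap F (bmap (ract V) (idm m) (fwd (GinvG d)))
    ∘ unmate (radj_adj (rgv gV (G d))) (radj_adj (rgv gW (G d))) (fun n => g n (G d)) m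
    ∘ bmap (ract W) (idm (F m)) (bwd (GinvG d)).

Lemma rconjK (f : forall (m : M) (d : D), Hom (ract W (F m) d) (F (ract V m d)))
  (f_nat : forall m m' d d' (h : Hom m m') (k : Hom d d'),
    f m' d' ∘ bmap (ract W) (fmap F h) k = fmap F (bmap (ract V) h k) ∘ f m d)
  (m : M) (d : D) : rconj_inv (rconj f) m d = f m d.
Proof.
rewrite /rconj_inv /rconj mateK; first by move=> *; exact: f_nat.
rewrite -f_nat -compA -bmapM fwdK fmap1 comp1m.
by rewrite bmap1 compm1.
Qed.

Lemma rconj_invK
  (g : forall (m : M) (d : D), Hom (F (rpar gV m d)) (rpar gW (F m) d))
  (g_nat : forall m m' d d' (h : Hom m m') (k : Hom d d'),
    g m' d' ∘ fmap F (bmap (rpar gV) h k) = bmap (rpar gW) (fmap F h) k ∘ g m d)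
  (m : M) (d : D) : rconj (rconj_inv g) m d = g m d.
Proof.
have g_natm a n n' (h : Hom n n') :
    g n' a ∘ fmap F (fmap (rgv gV a) h) = fmap (rgv gW a) (fmap F h) ∘ g n a.
  have := g_nat n n' a a h (idm a).
  have bE X (U : RightModule D X) (gU : RightGV U) p q (l : Hom p q) :
      bmap (rpar gU) l (idm a) = fmap (rgv gU a) l.
    rewrite -[RHS]comp1m -(conjugate_id (radj_adj (rgv gU a))) /conjugate /=.
    by rewrite /rpar_map /conjugate Ginvmap1 bmap1.
  by rewrite !bE.
rewrite -[RHS](unmateK (g := fun n => g n d)
  (radj_adj (rgv gV d)) (radj_adj (rgv gW d)) (g_natm d)).
apply: mate_ext; rewrite /rconj_inv.
have E : bwd (GinvG (Ginv d)) = Ginvmap (fwd (GGinv d)).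
  rewrite -[RHS]comp1m -(bwdK (GinvG (Ginv d))) -compA GinvG_tri.
  by rewrite compm1.
rewrite E -[LHS]compA -(unmate_nat (F := F)
  (ad := radj_adj (rgv gV (G (Ginv d)))) (ad1 := radj_adj (rgv gV d))
  (ad' := radj_adj (rgv gW (G (Ginv d)))) (ad1' := radj_adj (rgv gW d))
  (t := fun n => bmap (ract V) (idm n) (Ginvmap (fwd (GGinv d))))
  (t' := fun n => bmap (ract W) (idm n) (Ginvmap (fwd (GGinv d))))
  (g := fun n => g n (G (Ginv d))) (g1 := fun n => g n d)).
- by move=> *; symmetry; exact: bmap_swap.
- by move=> *; symmetry; exact: bmap_swap.
- exact: g_natm.
- move=> n; have := g_nat n n _ _ (idm n) (fwd (GGinv d)).
  by rewrite /= /rpar_map !fmap1 !compm1.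
- rewrite compA -fmapM -bmapM GinvG_tri comp1m.
  by rewrite bmap1 fmap1 comp1m.
Qed.

End RightConjugation.

Definition lregular (C : Monoidal) : LeftModule C C := {|
  lact := tensor C;
  lassoc := massoc (m := C);
  lassoc_nat := massoc_nat (m := C);
  lunit := mlunit (m := C);
  lunit_nat := mlunit_nat (m := C);
  lpentagon := mpentagon (m := C);
  ltriangle := mtriangle (m := C) |}.

Definition rregular (D : Monoidal) : RightModule D D := {|
  ract := tensor D;
  rassoc := massoc (m := D);
  rassoc_nat := massoc_nat (m := D);
  runit := mrunit (m := D);
  runit_nat := mrunit_nat (m := D);
  rpentagon := mpentagon (m := D);
  rtriangle := mtriangle (m := D) |}.

Definition bfun_l_niso (A B E : Category) (T : Bifunctor A B E) (a a' : A)
  (i : Iso a a') : NatIso (bfun_l T a) (bfun_l T a').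
Proof.
refine {| niso := fun b : B => fmap_iso (bfun_r T b) i
          : Iso (bfun_l T a b) (bfun_l T a' b) |}.
by move=> b b' f; exact: bmap_swap.
Defined.

Definition bfun_r_niso (A B E : Category) (T : Bifunctor A B E) (b b' : B)
  (i : Iso b b') : NatIso (bfun_r T b) (bfun_r T b').
Proof.
refine {| niso := fun a : A => fmap_iso (bfun_l T a) i
          : Iso (bfun_r T b a) (bfun_r T b' a) |}.
by move=> a a' f; symmetry; exact: bmap_swap.
Defined.

Lemma radj_tensor_l (C : GVCategory) (c : C) :
  inhabited (RightAdjoint (bfun_l (tensor C) c)).
Proof.
constructor; exists (bfun_l par (Ginv c)).
exact: adj_transfer (bfun_l_niso _ (iso_sym (GGinv c))) (ladj (Ginv c)).
Qed.

Lemma radj_tensor_r (C : GVCategory) (c : C) :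
  inhabited (RightAdjoint (bfun_r (tensor C) c)).
Proof.
constructor; exists (bfun_r par (G c)).
exact: adj_transfer (bfun_r_niso _ (iso_sym (GinvG c))) (radj_par (G c)).
Qed.

(* Here x ▶ y is x ⊙ y. *)
Definition lregular_gv (C : GVCategory) : LeftGV (lregular C) :=
  @Build_LeftGV C C (lregular C) (@radj_tensor_l C) (@radj_tensor_r C)
    (fun c => Build_RightAdjoint (ladj c)).

Definition rregular_gv (D : GVCategory) : RightGV (rregular D) :=
  @Build_RightGV D D (rregular D) (@radj_tensor_r D) (@radj_tensor_l D)
    (fun d => Build_RightAdjoint (radj_par d)).

Section LeftDistributors.
Context (C : GVCategory) (M : Category) (V : LeftModule C M) (gV : LeftGV V).

(* conjugate to the strong ▷-structure of - ▷ m : C -> M *)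
Definition ldist_par_tens (x y : C) (m : M) :
  Hom (lact V (x ⊙ y) m) (lpar gV x (lact V y m)) :=
  lconj (lregular_gv C) gV (F := bfun_r (lact V) m)
    (fun c z => bwd (lassoc V c z m)) x y.

(* conjugate to the strong ▶-structure of - ▶ m : C -> M *)
Definition ldist_tens_par (x y : C) (m : M) :
  Hom (lact V x (lpar gV y m)) (lpar gV (x ⊗ y) m) :=
  lconj_inv (gV := lregular_gv C) (gW := gV) (F := bfun_r (lpar gV) m)
    (fun c z => fwd (lpar_assoc gV c z m)) x y.

End LeftDistributors.

Section RightDistributors.
Context (D : GVCategory) (M : Category) (V : RightModule D M) (gV : RightGV V).

(* conjugate to the strong ◁-structure of m ◁ - : D -> M *)
Definition rdist_tens_par (m : M) (u v : D) :
  Hom (ract V m (u ⊙ v)) (rpar gV (ract V m u) v) :=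
  rconj (rregular_gv D) gV (F := bfun_l (ract V) m)
    (fun w d => fwd (rassoc V m w d)) u v.

(* conjugate to the strong ◀-structure of m ◀ - : D -> M *)
Definition rdist_par_tens (m : M) (u v : D) :
  Hom (ract V (rpar gV m u) v) (rpar gV m (u ⊗ v)) :=
  rconj_inv (gV := rregular_gv D) (gW := gV) (F := bfun_l (rpar gV) m)
    (fun w d => bwd (rpar_assoc gV m w d)) u v.

End RightDistributors.

Record GVBimodule (C D : GVCategory) (M : Category) := {
  gvb :> Bimodule C D M;
  gvb_l : LeftGV (bimod_l gvb);
  gvb_r : RightGV (bimod_r gvb) }.

Section BimoduleDistributors.
Context (C D : GVCategory) (M : Category) (V : GVBimodule C D M).

(* The left adjoints of c ▶ (- ◀ d) and (c ▶ -) ◀ d *)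
Definition bpar_niso (c : C) (d : D) :
  NatIso (fcomp (bfun_r (ract (bimod_r V)) (Ginv d)) (bfun_l (lact (bimod_l V)) (G c)))
         (fcomp (bfun_l (lact (bimod_l V)) (G c)) (bfun_r (ract (bimod_r V)) (Ginv d))).
Proof.
refine {| niso := fun m : M => bassoc V (G c) m (Ginv d)
  : Iso (fcomp (bfun_r (ract (bimod_r V)) (Ginv d))
               (bfun_l (lact (bimod_l V)) (G c)) m)
        (fcomp (bfun_l (lact (bimod_l V)) (G c))
               (bfun_r (ract (bimod_r V)) (Ginv d)) m) |}.
by move=> m m' f; exact: bassoc_nat.
Defined.

Definition bpar_assoc (c : C) (m : M) (d : D) :
  Iso (rpar (gvb_r V) (lpar (gvb_l V) c m) d)
      (lpar (gvb_l V) c (rpar (gvb_r V) m d)) :=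
  conjugate_iso
    (adj_comp (radj_adj (rgv (gvb_r V) d)) (radj_adj (lgv (gvb_l V) c)))
    (adj_comp (radj_adj (lgv (gvb_l V) c)) (radj_adj (rgv (gvb_r V) d)))
    (bpar_niso c d) m.

(* conjugate to the strong ◁-structure of c ▷ - : M -> M *)
Definition bdist_tens_par (c : C) (m : M) (d : D) :
  Hom (lact (bimod_l V) c (rpar (gvb_r V) m d))
      (rpar (gvb_r V) (lact (bimod_l V) c m) d) :=
  rconj (gvb_r V) (gvb_r V) (F := bfun_l (lact (bimod_l V)) c)
    (fun n e => fwd (bassoc V c n e)) m d.

(* conjugate to the strong ◀-structure of c ▶ - : M -> M *)
Definition bdist_par_tens (c : C) (m : M) (d : D) :
  Hom (ract (bimod_r V) (lpar (gvb_l V) c m) d)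
      (lpar (gvb_l V) c (ract (bimod_r V) m d)) :=
  rconj_inv (gV := gvb_r V) (gW := gvb_r V) (F := bfun_l (lpar (gvb_l V)) c)
    (fun n e => bwd (bpar_assoc c n e)) m d.

End BimoduleDistributors.

Inductive oper := tens | parr.

(* The edge between l = (p □ q) □' r and r = p □ (q □' r). *)
Definition edge (o o' : oper) (X : Category) (l r : X) : Type :=
  match o, o' with
  | tens, tens | parr, parr => Iso l r
  | parr, tens => Hom l r
  | tens, parr => Hom r l
  end.

Definition edge_map (o o' : oper) (X Y : Category) (F : Functor X Y) (l r : X) :
  edge o o' l r -> edge o o' (F l) (F r) :=
  match o, o' return edge o o' l r -> edge o o' (F l) (F r) with
  | tens, tens | parr, parr => fun e => fmap_iso F e
  | parr, tens | tens, parr => fun e => fmap F e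
  end.

Section Edges.
Context (C D : GVCategory) (M : Category) (V : GVBimodule C D M).

Definition cbox (E : GVCategory) (o : oper) : Bifunctor E E E :=
  match o with tens => tensor E | parr => par end.
Definition lbox (o : oper) : Bifunctor C M M :=
  match o with tens => lact (bimod_l V) | parr => lpar (gvb_l V) end.
Definition rbox (o : oper) : Bifunctor M D M :=
  match o with tens => ract (bimod_r V) | parr => rpar (gvb_r V) end.

(* The distributors of C are those of its regular left module, as C acts from
   the left; dually, those of D below are taken from its regular right module. *)
Definition edge_CCC (o o' : oper) (x y z : C) :
  edge o o' (cbox C o' (cbox C o x y) z) (cbox C o x (cbox C o' y z)) :=
  match o, o' return
    edge o o' (cbox C o' (cbox C o x y) z) (cbox C o x (cbox C o' y z)) with
  | tens, tens => massoc x y z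
  | parr, parr => par_assoc x y z
  | parr, tens => ldist_par_tens (lregular_gv C) x y z
  | tens, parr => ldist_tens_par (lregular_gv C) x y z
  end.

Definition edge_CCM (o o' : oper) (x y : C) (m : M) :
  edge o o' (lbox o' (cbox C o x y) m) (lbox o x (lbox o' y m)) :=
  match o, o' return
    edge o o' (lbox o' (cbox C o x y) m) (lbox o x (lbox o' y m)) with
  | tens, tens => lassoc (bimod_l V) x y m
  | parr, parr => lpar_assoc (gvb_l V) x y m
  | parr, tens => ldist_par_tens (gvb_l V) x y m
  | tens, parr => ldist_tens_par (gvb_l V) x y m
  end.

Definition edge_CMD (o o' : oper) (c : C) (m : M) (d : D) :
  edge o o' (rbox o' (lbox o c m) d) (lbox o c (rbox o' m d)) :=
  match o, o' return
    edge o o' (rbox o' (lbox o c m) d) (lbox o c (rbox o' m d)) with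
  | tens, tens => bassoc V c m d
  | parr, parr => bpar_assoc V c m d
  | parr, tens => bdist_par_tens V c m d
  | tens, parr => bdist_tens_par V c m d
  end.

Definition edge_MDD (o o' : oper) (m : M) (u v : D) :
  edge o o' (rbox o' (rbox o m u) v) (rbox o m (cbox D o' u v)) :=
  match o, o' return
    edge o o' (rbox o' (rbox o m u) v) (rbox o m (cbox D o' u v)) with
  | tens, tens => rassoc (bimod_r V) m u v
  | parr, parr => rpar_assoc (gvb_r V) m u v
  | parr, tens => rdist_par_tens (gvb_r V) m u v
  | tens, parr => rdist_tens_par (gvb_r V) m u v
  end.

Definition edge_DDD (o o' : oper) (u v w : D) :
  edge o o' (cbox D o' (cbox D o u v) w) (cbox D o u (cbox D o' v w)) :=
  match o, o' return
    edge o o' (cbox D o' (cbox D o u v) w) (cbox D o u (cbox D o' v w)) with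
  | tens, tens => massoc u v w
  | parr, parr => par_assoc u v w
  | parr, tens => rdist_par_tens (rregular_gv D) u v w
  | tens, parr => rdist_tens_par (rregular_gv D) u v w
  end.

End Edges.

(* For the pentagon below, the edges between v1 and v2 and between v3 and v4 are
   images of edges under - □3 d and a □1 -. In each case, the two composites of
   the edges, with invertible ones oriented suitably, are equal.

     v1 = ((a □1 b) □2 c) □3 d  --e1--  v2 = (a □1 (b □2 c)) □3 d
     v2                         --e2--  v3 = a □1 ((b □2 c) □3 d)
     v3                         --e3--  v4 = a □1 (b □2 (c □3 d))
     v1                         --e4--  v5 = (a □1 b) □2 (c □3 d)
     v5                         --e5--  v4                                  *)
Definition pentagon (o1 o2 o3 : oper) (X : Category) (v1 v2 v3 v4 v5 : X) :
  edge o1 o2 v1 v2 -> edge o1 o3 v2 v3 -> edge o2 o3 v3 v4 ->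
  edge o2 o3 v1 v5 -> edge o1 o2 v5 v4 -> Prop :=
  match o1, o2, o3 return
    edge o1 o2 v1 v2 -> edge o1 o3 v2 v3 -> edge o2 o3 v3 v4 ->
    edge o2 o3 v1 v5 -> edge o1 o2 v5 v4 -> Prop with
  | tens, tens, tens => fun e1 e2 e3 e4 e5 =>
      fwd e3 ∘ fwd e2 ∘ fwd e1 = fwd e5 ∘ fwd e4
  | parr, parr, parr => fun e1 e2 e3 e4 e5 =>
      fwd e3 ∘ fwd e2 ∘ fwd e1 = fwd e5 ∘ fwd e4
  | parr, tens, tens => fun e1 e2 e3 e4 e5 =>
      fwd e3 ∘ e2 ∘ e1 = e5 ∘ fwd e4
  | parr, parr, tens => fun e1 e2 e3 e4 e5 =>
      e3 ∘ e2 ∘ fwd e1 = fwd e5 ∘ e4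
  | tens, tens, parr => fun e1 e2 e3 e4 e5 =>
      bwd e1 ∘ e2 ∘ e3 = e4 ∘ bwd e5
  | tens, parr, parr => fun e1 e2 e3 e4 e5 =>
      e1 ∘ e2 ∘ bwd e3 = bwd e4 ∘ e5
  | tens, parr, tens => fun e1 e2 e3 e4 e5 =>
      e4 ∘ e1 = e5 ∘ e3 ∘ fwd e2
  | parr, tens, parr => fun e1 e2 e3 e4 e5 =>
      fwd e2 ∘ e1 ∘ e4 = e3 ∘ e5
  end.

Section PentagonPositions.
Context (C D : GVCategory) (M : Category) (V : GVBimodule C D M).

Definition pentagon_MDDD (o1 o2 o3 : oper) (m : M) (u v w : D) : Prop :=
  pentagon
    (edge_map (bfun_r (rbox V o3) w) (edge_MDD V o1 o2 m u v))
    (edge_MDD V o1 o3 m (cbox D o2 u v) w)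
    (edge_map (bfun_l (rbox V o1) m) (edge_DDD o2 o3 u v w))
    (edge_MDD V o2 o3 (rbox V o1 m u) v w)
    (edge_MDD V o1 o2 m u (cbox D o3 v w)).

Definition pentagon_CMDD (o1 o2 o3 : oper) (c : C) (m : M) (u v : D) : Prop :=
  pentagon
    (edge_map (bfun_r (rbox V o3) v) (edge_CMD V o1 o2 c m u))
    (edge_CMD V o1 o3 c (rbox V o2 m u) v)
    (edge_map (bfun_l (lbox V o1) c) (edge_MDD V o2 o3 m u v))
    (edge_MDD V o2 o3 (lbox V o1 c m) u v)
    (edge_CMD V o1 o2 c m (cbox D o3 u v)).

Definition pentagon_CCMD (o1 o2 o3 : oper) (x y : C) (m : M) (d : D) : Prop :=
  pentagon
    (edge_map (bfun_r (rbox V o3) d) (edge_CCM V o1 o2 x y m))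
    (edge_CMD V o1 o3 x (lbox V o2 y m) d)
    (edge_map (bfun_l (lbox V o1) x) (edge_CMD V o2 o3 y m d))
    (edge_CMD V o2 o3 (cbox C o1 x y) m d)
    (edge_CCM V o1 o2 x y (rbox V o3 m d)).

Definition pentagon_CCCM (o1 o2 o3 : oper) (x y z : C) (m : M) : Prop :=
  pentagon
    (edge_map (bfun_r (lbox V o3) m) (edge_CCC o1 o2 x y z))
    (edge_CCM V o1 o3 x (cbox C o2 y z) m)
    (edge_map (bfun_l (lbox V o1) x) (edge_CCM V o2 o3 y z m))
    (edge_CCM V o2 o3 (cbox C o1 x y) z m)
    (edge_CCM V o1 o2 x y (lbox V o3 z m)).

End PentagonPositions.

(* Main.v *)
From Corelib Require Import ssreflect.
Require Import Defs.

Set Implicit Arguments.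
Unset Strict Implicit.
Unset Printing Implicit Defensive.

(** Suppose that the module object is the third or fourth factor, and fix the last
    factor and the operation in front of it. Then [- □3 a4] is a functor [F] between
    left [C]-modules (from [C] or [M] to [M]). It has a lax structure
    [c ▷ F n -> F (c ▷ n)] for ▷, namely an inverse associator or a distributor, and
    the other edge that moves [c] past [F], the one for ▶, is the conjugate oplax
    structure. So the pentagons with [□3] fixed speak of a lax module functor and its
    conjugate. For [(□1, □2) = (⊗, ⊗)] the pentagon is the associativity of the lax
    structure. The other three hold for every lax module functor [F]
    ([lax_par_tens], [lax_tens_par], [lax_par_par]), for the following reason. Write
    [S] for the dual. Transposing along the universal evaluation
    [S c ▷ (c ▶ m) -> m] turns each of the edges between [(x □1 y) □2 n] and
    [x □1 (y □2 n)] into the action of one morphism of [C], followed by an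
    evaluation if a ▶ is left:

    - [S x ⊗ (x ⊙ y) -> y], the evaluation of [C], for [(⊙, ⊗)];
    - [S (x ⊗ y) ⊗ x -> S y], here [dual_cancel], for [(⊗, ⊙)];
    - [S y ⊗ S x -> S (x ⊙ y)], here [dual_par], for [(⊙, ⊙)].

    A lax structure commutes with the action of a morphism [p ⊗ q -> s]
    ([lax_act_via]), and transposing the pentagons leaves nothing else to check.

    It remains to see that the edges are these canonical ones. Each functor
    [- □3 a4] has a lax structure: for [- ▶ m] its associativity comes from the
    pairing [S y ⊗ y -> K] ([dual_cancel_assoc]), for [- ◀ d] from the pentagon
    of the bimodule constraint ([swap_par_assoc]). The distributors defined by
    inverting a conjugation are then recognized by conjugating once more, since
    the conjugation is a bijection.

    The pentagons with the module object in the first two places are the mirror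
    images of the others: a right [D]-module is a left module over the reversed
    monoidal category, in which [Ginv] is the dual. The mirror is not perfect,
    because ⊙ and its associator are defined from [G] alone. That the associator is
    also the canonical one for the right evaluations
    [(x ⊙ y) ⊗ Ginv y -> x] ([par_assoc_right]) rests on the compatibility of the
    left and right evaluations under the pairings with [K] ([pairing_evr]). *)

(** * Isomorphisms and inverse constraints *)

Section Isos.
Context (X : Category).

Lemma fwdKA (a x y : X) (i : Iso x y) (f : Hom a y) : fwd i ∘ (bwd i ∘ f) = f.
Proof. by rewrite compA fwdK comp1m. Qed.

Lemma bwdKA (a x y : X) (i : Iso x y) (f : Hom a x) : bwd i ∘ (fwd i ∘ f) = f.
Proof. by rewrite compA bwdK comp1m. Qed.

Lemma iso_monic (a x y : X) (i : Iso x y) (f g : Hom a x) :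
  fwd i ∘ f = fwd i ∘ g -> f = g.
Proof. by move=> E; rewrite -(bwdKA i f) E bwdKA. Qed.

Lemma iso_epic (a x y : X) (i : Iso x y) (f g : Hom y a) :
  f ∘ fwd i = g ∘ fwd i -> f = g.
Proof. by move=> E; rewrite -(compm1 f) -(fwdK i) compA E -compA fwdK compm1. Qed.

Lemma iso_inv_eq (x y : X) (i j : Iso x y) : bwd i = bwd j -> fwd i = fwd j.
Proof. by move=> E; rewrite -(comp1m (fwd i)) -(fwdK j) -E -compA bwdK compm1. Qed.

End Isos.

Section Bifunctors.
Context (A B E : Category) (T : Bifunctor A B E).

Lemma bmap_lr a a' b b' (f : Hom a a') (h : Hom b b') :
  bmap T f h = bmap T (idm a') h ∘ bmap T f (idm b).
Proof. by rewrite -bmapM comp1m compm1. Qed.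

Lemma bmap_rl a a' b b' (f : Hom a a') (h : Hom b b') :
  bmap T f h = bmap T f (idm b') ∘ bmap T (idm a) h.
Proof. by rewrite -bmapM comp1m compm1. Qed.

Lemma bmap_l a b b' b'' (k : Hom b' b'') (h : Hom b b') :
  bmap T (idm a) (k ∘ h) = bmap T (idm a) k ∘ bmap T (idm a) h.
Proof. by rewrite -bmapM comp1m. Qed.

Lemma bmap_r b a a' a'' (k : Hom a' a'') (h : Hom a a') :
  bmap T (k ∘ h) (idm b) = bmap T k (idm b) ∘ bmap T h (idm b).
Proof. by rewrite -bmapM comp1m. Qed.

End Bifunctors.

Lemma massoc_nat_bwd (C : Monoidal) (x x' y y' z z' : C)
    (f : Hom x x') (g : Hom y y') (h : Hom z z') :
  bwd (massoc x' y' z') ∘ (f ⊗m g ⊗m h) = ((f ⊗m g) ⊗m h) ∘ bwd (massoc x y z).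
Proof.
apply: (iso_epic (i := massoc x y z)); rewrite -!compA bwdK compm1 -massoc_nat.
by rewrite bwdKA.
Qed.

Lemma lassoc_nat_bwd (C : Monoidal) (M : Category) (V : LeftModule C M)
    (x x' y y' : C) (m m' : M) (f : Hom x x') (g : Hom y y') (h : Hom m m') :
  bwd (lassoc V x' y' m') ∘ bmap (lact V) f (bmap (lact V) g h) =
  bmap (lact V) (f ⊗m g) h ∘ bwd (lassoc V x y m).
Proof.
apply: (iso_epic (i := lassoc V x y m)); rewrite -!compA bwdK compm1 -lassoc_nat.
by rewrite bwdKA.
Qed.

Lemma lpentagon_bwd (C : Monoidal) (M : Category) (V : LeftModule C M)
    (x y z : C) (m : M) :
  bmap (lact V) (bwd (massoc x y z)) (idm m) ∘ bwd (lassoc V x (y ⊗ z) m)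
    ∘ bmap (lact V) (idm x) (bwd (lassoc V y z m)) =
  bwd (lassoc V (x ⊗ y) z m) ∘ bwd (lassoc V x y (lact V z m)).
Proof.
apply: (iso_epic (i := lassoc V x y _)); rewrite -!compA bwdK compm1.
apply: (iso_epic (i := lassoc V (x ⊗ y) z m)); rewrite bwdK -!compA -lpentagon.
rewrite !compA -!(compA (bmap _ _ _ ∘ bwd _)) -bmap_l bwdK bmap1 comp1m.
by rewrite -!compA bwdKA -bmap_r bwdK bmap1.
Qed.

Lemma mpentagon_bwd (C : Monoidal) (x y z w : C) :
  (bwd (massoc x y z) ⊗m idm w) ∘ bwd (massoc x (y ⊗ z) w)
    ∘ (idm x ⊗m bwd (massoc y z w)) =
  bwd (massoc (x ⊗ y) z w) ∘ bwd (massoc x y (z ⊗ w)).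
Proof. exact: (lpentagon_bwd (lregular C)). Qed.

(** * The duality pairing *)

Section Pairing.
Context (C : Monoidal) (K : C) (r : Representation K).
Local Notation S := (dual_obj r).

Definition pairing (y : C) : Hom (S y ⊗ y) K := bfrom (rep r) (idm (S y)).

Lemma pairingE (x y : C) (g : Hom x (S y)) :
  pairing y ∘ (g ⊗m idm y) = bfrom (rep r) g.
Proof. by rewrite -rep_from_nat comp1m. Qed.

Lemma pairing_inj (x y : C) (g g' : Hom x (S y)) :
  pairing y ∘ (g ⊗m idm y) = pairing y ∘ (g' ⊗m idm y) -> g = g'.
Proof. by rewrite !pairingE => E; rewrite -(btoK (rep r) g) E btoK. Qed.

Lemma pairing_rep (x y : C) (h : Hom (x ⊗ y) K) :
  pairing y ∘ (rep r h ⊗m idm y) = h.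
Proof. by rewrite pairingE bfromK. Qed.

Lemma pairing_dual (a b y y' : C) (f : Hom y y') (u : Hom a (S y')) (h : Hom b y) :
  pairing y ∘ ((dual_map r f ∘ u) ⊗m h) = pairing y' ∘ (u ⊗m (f ∘ h)).
Proof.
rewrite -[h]comp1m bmapM compA pairing_rep -compA -bmapM.
by rewrite !comp1m.
Qed.

Lemma dual_map1 (y : C) : dual_map r (idm y) = idm (S y).
Proof. exact: (fmap1 (dual_functor r)). Qed.

(** The morphism that corresponds to the evaluation [S (x ⊗ y) ⊗ x ⊗ y -> K]. The
    distributor [x ▷ (y ▶ m) -> (x ⊗ y) ▶ m] is its action, transposed. *)
Definition dual_cancel (x y : C) : Hom (S (x ⊗ y) ⊗ x) (S y) :=
  rep r (pairing (x ⊗ y) ∘ fwd (massoc _ x y)).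

Lemma pairing_cancel (a b x y : C) (u : Hom a (S (x ⊗ y) ⊗ x)) (h : Hom b y) :
  pairing y ∘ ((dual_cancel x y ∘ u) ⊗m h) =
  pairing (x ⊗ y) ∘ fwd (massoc _ x y) ∘ (u ⊗m h).
Proof. by rewrite -[h in LHS]comp1m bmapM compA pairing_rep. Qed.

Lemma dual_cancel_nat (x x' y y' : C) (f : Hom x x') (g : Hom y y') :
  dual_map r g ∘ (dual_cancel x' y' ∘ (idm _ ⊗m f)) =
  dual_cancel x y ∘ (dual_map r (f ⊗m g) ⊗m idm x).
Proof.
apply: pairing_inj; rewrite pairing_dual !pairing_cancel -!compA !massoc_nat.
rewrite !compA; congr (_ ∘ _).
by rewrite bmap1 -[dual_map _ _]compm1 pairing_dual !compm1.
Qed.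

(** Cancelling [x], then [y], is cancelling [x ⊗ y]: both sides pair with [z] to the
    evaluation at [x ⊗ y ⊗ z]. *)
Lemma dual_cancel_assoc (x y z : C) :
  dual_cancel y z
    ∘ ((dual_cancel x (y ⊗ z) ∘ (dual_map r (bwd (massoc x y z)) ⊗m idm x)) ⊗m idm y) =
  dual_cancel (x ⊗ y) z ∘ fwd (massoc _ x y).
Proof.
apply: pairing_inj; rewrite !pairing_cancel -(compA (pairing (y ⊗ z))) massoc_nat.
rewrite bmap1 compA pairing_cancel -(compA (pairing _) _ (_ ⊗m _)) massoc_nat bmap1 compA.
rewrite -[dual_map _ _]compm1 pairing_dual compm1 -!compA -mpentagon.
rewrite (compA (_ ⊗m bwd _)) (compA (_ ⊗m bwd _)).
by rewrite -bmap_l bwdK bmap1 comp1m.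
Qed.

End Pairing.

(** * Actions ▶ given by their universal evaluations *)

(** [pcur] is the transposition along the evaluations [pev], which [pcurK] and
    [pcur_inj] make universal: [pact c] is right adjoint to [T (S c)]. A bifunctor
    [T] is used instead of a module, so that left and right modules, and [C] acting
    on itself, are all covered without comparing proofs of module axioms. *)
Record ParAction (C : Monoidal) (K : C) (r : Representation K) (M : Category)
    (T : Bifunctor C M M) := {
  pact :> Bifunctor C M M;
  pev : forall (c : C) (m : M), Hom (T (dual_obj r c) (pact c m)) m;
  pcur : forall (c : C) (m n : M), Hom (T (dual_obj r c) n) m -> Hom n (pact c m);
  pev_nat : forall (c c' : C) (m m' : M) (f : Hom c c') (h : Hom m m'),
    pev c' m' ∘ bmap T (idm _) (bmap pact f h) =
    h ∘ pev c m ∘ bmap T (dual_map r f) (idm _);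
  pcurK : forall (c : C) (m n : M) (g : Hom (T (dual_obj r c) n) m),
    pev c m ∘ bmap T (idm _) (pcur g) = g;
  pcur_inj : forall (c : C) (m n : M) (f f' : Hom n (pact c m)),
    pev c m ∘ bmap T (idm _) f = pev c m ∘ bmap T (idm _) f' -> f = f' }.

Section Transpose.
Context (C : Monoidal) (K : C) (r : Representation K) (M : Category).
Context (T : Bifunctor C M M) (P : ParAction r T).
Local Notation S := (dual_obj r).

(** Locked, as is [act_via] below: associativity rewriting must not split them. *)
Definition transp (c : C) (m n : M) (f : Hom n (P c m)) : Hom (T (S c) n) m :=
  locked (pev P c m ∘ bmap T (idm _) f).

Lemma transpE (c : C) (m n : M) (f : Hom n (P c m)) :
  transp f = pev P c m ∘ bmap T (idm _) f.
Proof. by rewrite /transp -lock. Qed.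

Lemma transp_inj (c : C) (m n : M) (f f' : Hom n (P c m)) :
  transp f = transp f' -> f = f'.
Proof. by rewrite !transpE; exact: pcur_inj. Qed.

Lemma transp_cur (c : C) (m n : M) (g : Hom (T (S c) n) m) : transp (pcur P g) = g.
Proof. by rewrite transpE pcurK. Qed.

Lemma transp_comp (c : C) (m n n' : M) (f : Hom n (P c m)) (h : Hom n' n) :
  transp (f ∘ h) = transp f ∘ bmap T (idm _) h.
Proof. by rewrite !transpE bmap_l compA. Qed.

Lemma transp_map (c c' : C) (m m' n : M) (f : Hom c c') (h : Hom m m')
    (k : Hom n (P c m)) :
  transp (bmap P f h ∘ k) = h ∘ transp k ∘ bmap T (dual_map r f) (idm n).
Proof.
rewrite transp_comp !transpE pev_nat -!compA -!bmapM.
by rewrite !comp1m !compm1.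
Qed.

Lemma transp_post (c : C) (m m' n : M) (h : Hom m m') (k : Hom n (P c m)) :
  transp (bmap P (idm c) h ∘ k) = h ∘ transp k.
Proof. by rewrite transp_map dual_map1 bmap1 compm1. Qed.

End Transpose.

(** * Acting through a morphism [p ⊗ q -> s] *)

Section ActVia.
Context (C : Monoidal) (M : Category) (V : LeftModule C M).
Local Notation T := (lact V).

(** The transposes of all canonical distributors have this form. *)
Definition act_via (p q s : C) (u : Hom (p ⊗ q) s) (m : M) : Hom (T p (T q m)) (T s m) :=
  locked (bmap T u (idm m) ∘ bwd (lassoc V p q m)).

Lemma act_viaE (p q s : C) (u : Hom (p ⊗ q) s) (m : M) :
  act_via u m = bmap T u (idm m) ∘ bwd (lassoc V p q m).
Proof. by rewrite /act_via -lock. Qed.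

Lemma act_via_nat (p q s p' q' s' : C) (m m' : M) (u : Hom (p ⊗ q) s)
    (u' : Hom (p' ⊗ q') s') (f : Hom p p') (g : Hom q q') (k : Hom s s') (h : Hom m m') :
  u' ∘ (f ⊗m g) = k ∘ u ->
  act_via u' m' ∘ bmap T f (bmap T g h) = bmap T k h ∘ act_via u m.
Proof.
move=> E; rewrite !act_viaE -compA lassoc_nat_bwd !compA; congr (_ ∘ _).
by rewrite -!bmapM E comp1m compm1.
Qed.

Lemma act_via_post (p q s s' : C) (m : M) (u : Hom (p ⊗ q) s) (k : Hom s s') :
  bmap T k (idm m) ∘ act_via u m = act_via (k ∘ u) m.
Proof. by rewrite !act_viaE compA -bmap_r. Qed.

Lemma act_via_pre (p p' q s : C) (m : M) (u : Hom (p ⊗ q) s) (f : Hom p' p) :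
  act_via u m ∘ bmap T f (idm _) = act_via (u ∘ (f ⊗m idm q)) m.
Proof.
rewrite -(bmap1 T) (act_via_nat _ (k := idm s) (u := u ∘ (f ⊗m idm q))) ?comp1m //.
by rewrite bmap1 comp1m.
Qed.

Lemma act_via_via (p q p' w s : C) (m : M) (v : Hom (p ⊗ q) p') (u : Hom (p' ⊗ w) s) :
  act_via u m ∘ act_via v (T w m) =
  bmap T (u ∘ (v ⊗m idm w)) (idm m)
    ∘ (bwd (lassoc V (p ⊗ q) w m) ∘ bwd (lassoc V p q (T w m))).
Proof.
rewrite !act_viaE bmap_r -!compA; congr (_ ∘ _); rewrite !compA; congr (_ ∘ _).
by rewrite -lassoc_nat_bwd bmap1.
Qed.

Lemma act_via_assoc (p q w s : C) (m : M) (u : Hom (p ⊗ q ⊗ w) s) :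
  act_via u m ∘ bmap T (idm p) (bwd (lassoc V q w m)) =
  bmap T (u ∘ fwd (massoc p q w)) (idm m)
    ∘ (bwd (lassoc V (p ⊗ q) w m) ∘ bwd (lassoc V p q (T w m))).
Proof.
rewrite -lpentagon_bwd act_viaE !compA -bmap_r; congr (_ ∘ _ ∘ _).
by rewrite -compA fwdK compm1.
Qed.

End ActVia.

(** * Lax module functors and their conjugates *)

(** What the functors [- □3 a4] have in common. *)
Record LaxFunctor (C : Monoidal) (N M : Category) (U : LeftModule C N)
    (V : LeftModule C M) := {
  lax_fun :> Functor N M;
  lax_map : forall (c : C) (n : N), Hom (lact V c (lax_fun n)) (lax_fun (lact U c n));
  lax_nat : forall (c c' : C) (n n' : N) (k : Hom c c') (h : Hom n n'),
    lax_map c' n' ∘ bmap (lact V) k (fmap lax_fun h) =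
    fmap lax_fun (bmap (lact U) k h) ∘ lax_map c n;
  lax_assoc : forall (x y : C) (n : N),
    fmap lax_fun (bwd (lassoc U x y n)) ∘ lax_map x (lact U y n)
      ∘ bmap (lact V) (idm x) (lax_map y n) =
    lax_map (x ⊗ y) n ∘ bwd (lassoc V x y (lax_fun n)) }.

Arguments lax_map {C N M U V} _ c n.

Section Conjugate.
Context (C : Monoidal) (K : C) (r : Representation K) (N M : Category).
Context (U : LeftModule C N) (V : LeftModule C M).
Context (Q : ParAction r (lact U)) (P : ParAction r (lact V)).
Local Notation S := (dual_obj r).

(** The form in which the pentagons use the associativity of a lax functor: letting
    a morphism [p ⊗ q -> s] act inside or outside [F] is the same. *)
Lemma lax_act_via (F : LaxFunctor U V) (p q s : C) (u : Hom (p ⊗ q) s) (n : N) :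
  fmap F (act_via U u n) ∘ lax_map F p (lact U q n) ∘ bmap (lact V) (idm p) (lax_map F q n) =
  lax_map F s n ∘ act_via V u (F n).
Proof.
rewrite !act_viaE fmapM -!compA (compA (fmap F (bwd _))) lax_assoc !compA.
by rewrite -lax_nat fmap1.
Qed.

Lemma lax_map_l (F : LaxFunctor U V) (c : C) (n n' : N) (h : Hom n n') :
  lax_map F c n' ∘ bmap (lact V) (idm c) (fmap F h) =
  fmap F (bmap (lact U) (idm c) h) ∘ lax_map F c n.
Proof. exact: lax_nat. Qed.

(** The conjugate oplax structure: the transpose of [F (S c ▷ (c ▶ n)) -> F n]
    precomposed with the lax structure. *)
Definition oplax_conj (F : LaxFunctor U V) (c : C) (n : N) : Hom (F (Q c n)) (P c (F n)) :=
  pcur P (fmap F (pev Q c n) ∘ lax_map F (S c) (Q c n)).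

Lemma transp_oplax_conj (F : LaxFunctor U V) (c : C) (n n' : N) (k : Hom n' (Q c n)) :
  transp (oplax_conj F c n ∘ fmap F k) = fmap F (transp k) ∘ lax_map F (S c) n'.
Proof. by rewrite transp_comp transp_cur -compA lax_map_l compA -fmapM transpE. Qed.

End Conjugate.

(** * The canonical distributors *)

Section Canonical.
Context (C : Monoidal) (K : C) (r : Representation K) (R : ParAction r (tensor C)).
Local Notation S := (dual_obj r).

(** The associator of ▶ is its action, transposed twice. It is written with
    [dual_cancel] because then the associator of ▶ is by definition the conjugate
    of the distributor [tens_par]. *)
Definition dual_par (x y : C) : Hom (S y ⊗ S x) (S (R x y)) :=
  locked (dual_cancel r (S x) (R x y) ∘ (dual_map r (pev R x y) ⊗m idm _)).

Lemma dual_parE (x y : C) :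
  dual_par x y = dual_cancel r (S x) (R x y) ∘ (dual_map r (pev R x y) ⊗m idm _).
Proof. by rewrite /dual_par -lock. Qed.

Lemma pairing_par (x y : C) :
  pairing r (R x y) ∘ (dual_par x y ⊗m idm _) =
  pairing r y ∘ (idm _ ⊗m pev R x y) ∘ fwd (massoc _ _ _).
Proof.
rewrite dual_parE pairing_cancel -compA massoc_nat bmap1 compA; congr (_ ∘ _).
by rewrite -[dual_map _ _]compm1 pairing_dual compm1.
Qed.

(** Recognizes the concrete isomorphisms [G y ⊗ G x = G (x ⊙ y)] and
    [Ginv v ⊗ Ginv u = Ginv (u ⊙ v)] as instances of [dual_par]. *)
Lemma dual_par_unique (x y : C) (t : Hom (S y ⊗ S x) (S (R x y))) :
  pairing r (R x y) ∘ (t ⊗m idm _) =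
  pairing r y ∘ (idm _ ⊗m pev R x y) ∘ fwd (massoc _ _ _) -> t = dual_par x y.
Proof. by rewrite -pairing_par; exact: pairing_inj. Qed.

Lemma pairing_pev (x y : C) :
  pairing r y ∘ (idm _ ⊗m pev R x y) =
  pairing r (R x y) ∘ ((dual_par x y ⊗m idm _) ∘ bwd (massoc _ _ _)).
Proof. by rewrite compA pairing_par -compA fwdK compm1. Qed.

(** Pairing a transpose moves the pairing from [y] to [x ⊙ y]; iterated, this
    compares transposes without unfolding them. *)
Lemma pairing_transp (x y n : C) (k : Hom n (R x y)) :
  pairing r y ∘ (idm _ ⊗m transp k) =
  pairing r (R x y) ∘ (dual_par x y ⊗m k) ∘ bwd (massoc _ _ _).
Proof.
rewrite [dual_par x y ⊗m k]bmap_rl compA pairing_par -!compA (compA (fwd _)).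
by rewrite -(bmap1 (tensor C)) massoc_nat -!compA fwdK compm1 -bmap_l transpE.
Qed.

Section Module.
Context (M : Category) (V : LeftModule C M) (P : ParAction r (lact V)).
Local Notation T := (lact V).

Definition tens_par (x y : C) (m : M) : Hom (T x (P y m)) (P (x ⊗ y) m) :=
  pcur P (pev P y m ∘ act_via V (dual_cancel r x y) (P y m)).

Lemma transp_tens_par (x y : C) (m n : M) (k : Hom n (P y m)) :
  transp (tens_par x y m ∘ bmap T (idm x) k) =
  transp k ∘ act_via V (dual_cancel r x y) n.
Proof.
rewrite transp_comp transp_cur -compA (act_via_nat _ (k := idm _) (u := dual_cancel r x y)).
  by rewrite bmap1 compm1 comp1m.
by rewrite compA -transpE.
Qed.

Lemma tens_par_nat (x x' y y' : C) (m m' : M) (f : Hom x x') (g : Hom y y')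
    (h : Hom m m') :
  tens_par x' y' m' ∘ bmap T f (bmap P g h) =
  bmap P (f ⊗m g) h ∘ tens_par x y m.
Proof.
apply: transp_inj; rewrite transp_map transp_cur.
rewrite transp_comp !transp_cur -!compA act_via_pre -dual_cancel_nat.
rewrite (act_via_nat _ (k := idm _) (u := dual_cancel r x' y' ∘ (idm _ ⊗m f))).
  by rewrite comp1m.
rewrite compA pev_nat -!compA act_via_post.
by [].
Qed.

Lemma tens_par_assoc (x y z : C) (m : M) :
  bmap P (bwd (massoc x y z)) (idm m) ∘ tens_par x (y ⊗ z) m
    ∘ bmap T (idm x) (tens_par y z m) =
  tens_par (x ⊗ y) z m ∘ bwd (lassoc V x y (P z m)).
Proof.
apply: transp_inj; rewrite -compA transp_map comp1m transp_tens_par transp_comp.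
rewrite !transp_cur -!compA; congr (_ ∘ _).
by rewrite act_via_pre act_via_via dual_cancel_assoc act_via_assoc.
Qed.

Definition tens_functor (m : M) : LaxFunctor (lregular C) V.
Proof.
refine (@Build_LaxFunctor C C M (lregular C) V (bfun_r T m)
  (fun c z => bwd (lassoc V c z m)) _ _).
- by move=> c c' z z' k h; exact: lassoc_nat_bwd.
- by move=> x y z; exact: lpentagon_bwd.
Defined.

(** With this lax structure on [- ▶ m], the associator of ▶ becomes a conjugate,
    just as the distributor [par_tens] is the conjugate for [- ▷ m]. *)
Definition par_functor (m : M) : LaxFunctor (lregular C) V.
Proof.
refine (@Build_LaxFunctor C C M (lregular C) V (bfun_r P m)
  (fun c z => tens_par c z m) _ _).
- by move=> c c' z z' k h; exact: tens_par_nat.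
- by move=> x y z; exact: tens_par_assoc.
Defined.

Definition par_tens (x y : C) (m : M) : Hom (T (R x y) m) (P x (T y m)) :=
  oplax_conj (U := lregular C) R P (tens_functor m) x y.

Definition par_par (x y : C) (m : M) : Hom (P (R x y) m) (P x (P y m)) :=
  oplax_conj (U := lregular C) R P (par_functor m) x y.

Lemma transp_par_tens (x y : C) (m : M) :
  transp (par_tens x y m) = act_via V (pev R x y) m.
Proof. by rewrite transp_cur act_viaE. Qed.

(** The associator of ▶ is the mate of [S y ▷ (S x ▷ -) -> S (x ⊙ y) ▷ -]. *)
Lemma transp_par_par (x y : C) (m : M) :
  transp (transp (par_par x y m)) = pev P _ m ∘ act_via V (dual_par x y) _.
Proof.
by rewrite transp_cur /= transp_map transp_cur comp1m -compA act_via_pre dual_parE.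
Qed.

Lemma par_par_unique (x y : C) (m : M) (a : Hom (P (R x y) m) (P x (P y m))) :
  transp (transp a) = pev P _ m ∘ act_via V (dual_par x y) _ -> a = par_par x y m.
Proof. by rewrite -transp_par_par => E; do 2! apply: transp_inj. Qed.

End Module.

(** If [z] is also detected by pairing on the left, the canonical associator of ⊙
    can be recognized from its image under [S]. *)
Lemma par_par_dual (x y z : C) (a : Hom (R (R x y) z) (R x (R y z)))
    (inj : forall (w : C) (g g' : Hom w z),
      pairing r z ∘ (idm _ ⊗m g) = pairing r z ∘ (idm _ ⊗m g') -> g = g') :
  dual_map r a ∘ dual_par x (R y z) ∘ (dual_par y z ⊗m idm (S x)) =
  dual_par (R x y) z ∘ (idm (S z) ⊗m dual_par x y) ∘ fwd (massoc _ _ _) ->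
  a = par_par (V := lregular C) R x y z.
Proof.
move=> E; apply: (par_par_unique (V := lregular C) (P := R)); apply: inj.
rewrite pairing_transp [_ ⊗m transp _]bmap_lr compA pairing_transp act_viaE /=.
rewrite !bmap_l [in RHS]compA pairing_pev -!compA.
rewrite -[a in LHS]compm1 [in LHS]compA -pairing_dual -!compA; congr (_ ∘ _).
rewrite -(bmap1 (tensor C) (S x)) !(compA (bwd _) (_ ⊗m _ ⊗m _)) !massoc_nat_bwd.
rewrite !compA -!bmap_r E.
rewrite -[LHS]compA -mpentagon_bwd !compA -bmap_r.
by rewrite -(compA _ (fwd _)) fwdK compm1.
Qed.

End Canonical.

(** * The pentagons of a lax module functor *)

Section LaxPentagons.
Context (C : Monoidal) (K : C) (r : Representation K) (R : ParAction r (tensor C)).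
Context (N M : Category) (U : LeftModule C N) (V : LeftModule C M).
Context (Q : ParAction r (lact U)) (P : ParAction r (lact V)).
Context (F : LaxFunctor U V).

Lemma lax_par_tens (x y : C) (n : N) :
  oplax_conj Q P F x (lact U y n) ∘ fmap F (par_tens R Q x y n) ∘ lax_map F (R x y) n =
  bmap P (idm x) (lax_map F y n) ∘ par_tens R P x y (F n).
Proof.
apply: transp_inj; rewrite transp_comp transp_oplax_conj transp_post !transp_par_tens.
exact: lax_act_via.
Qed.

Lemma lax_tens_par (x y : C) (n : N) :
  oplax_conj Q P F (x ⊗ y) n ∘ fmap F (tens_par Q x y n) ∘ lax_map F x (Q y n) =
  tens_par P x y (F n) ∘ bmap (lact V) (idm x) (oplax_conj Q P F y n).
Proof.
apply: transp_inj; rewrite transp_comp transp_oplax_conj transp_tens_par !transp_cur.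
by rewrite fmapM -!compA -lax_act_via -!compA.
Qed.

Lemma lax_par_par (x y : C) (n : N) :
  bmap P (idm x) (oplax_conj Q P F y n)
    ∘ (oplax_conj Q P F x (Q y n) ∘ fmap F (par_par R Q x y n)) =
  par_par R P x y (F n) ∘ oplax_conj Q P F (R x y) n.
Proof.
apply: transp_inj; rewrite transp_post transp_oplax_conj.
apply: transp_inj; rewrite compA transp_comp transp_oplax_conj transp_par_par.
rewrite transp_comp transp_comp transp_par_par fmapM -compA -compA.
rewrite [X in _ ∘ X]compA lax_act_via -(compA (pev P _ _)).
rewrite (act_via_nat _ (k := idm _) (u := dual_par R x y)).
  by rewrite bmap1 comp1m compm1.
rewrite (compA (pev P _ _)) -transpE transp_cur.
by rewrite -compA.
Qed.

End LaxPentagons.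

(** * Commuting actions *)

(** A bimodule as two left actions that commute up to isomorphism, so that
    [commuting_sym] exchanges the statements about the two sides. *)
Record Commuting (C E : Monoidal) (M : Category) (V : LeftModule C M)
    (W : LeftModule E M) := {
  swap : forall (c : C) (e : E) (m : M),
    Iso (lact W e (lact V c m)) (lact V c (lact W e m));
  swap_nat : forall (c c' : C) (e e' : E) (m m' : M) (f : Hom c c') (g : Hom e e')
      (h : Hom m m'),
    fwd (swap c' e' m') ∘ bmap (lact W) g (bmap (lact V) f h) =
    bmap (lact V) f (bmap (lact W) g h) ∘ fwd (swap c e m);
  swap_l : forall (x y : C) (e : E) (m : M),
    bmap (lact W) (idm e) (bwd (lassoc V x y m)) ∘ bwd (swap x e (lact V y m))
      ∘ bmap (lact V) (idm x) (bwd (swap y e m)) =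
    bwd (swap (x ⊗ y) e m) ∘ bwd (lassoc V x y (lact W e m));
  swap_r : forall (c : C) (x y : E) (m : M),
    bmap (lact V) (idm c) (bwd (lassoc W x y m)) ∘ fwd (swap c x (lact W y m))
      ∘ bmap (lact W) (idm x) (fwd (swap c y m)) =
    fwd (swap c (x ⊗ y) m) ∘ bwd (lassoc W x y (lact V c m)) }.

Lemma swap_nat_bwd (C E : Monoidal) (M : Category) (V : LeftModule C M)
    (W : LeftModule E M) (X : Commuting V W) (c c' : C) (e e' : E) (m m' : M)
    (f : Hom c c') (g : Hom e e') (h : Hom m m') :
  bwd (swap X c' e' m') ∘ bmap (lact V) f (bmap (lact W) g h) =
  bmap (lact W) g (bmap (lact V) f h) ∘ bwd (swap X c e m).
Proof.
apply: (iso_epic (i := swap X c e m)); rewrite -!compA bwdK compm1 -swap_nat.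
by rewrite bwdKA.
Qed.

Lemma swap_l_fwd (C E : Monoidal) (M : Category) (V : LeftModule C M)
    (W : LeftModule E M) (X : Commuting V W) (x y : C) (e : E) (m : M) :
  bwd (lassoc V x y _) ∘ (bmap (lact V) (idm x) (fwd (swap X y e m))
    ∘ fwd (swap X x e (lact V y m))) =
  fwd (swap X (x ⊗ y) e m) ∘ bmap (lact W) (idm e) (bwd (lassoc V x y m)).
Proof.
apply: (iso_monic (i := iso_sym (swap X (x ⊗ y) e m))) => /=.
rewrite bwdKA compA -swap_l -!compA (compA (bmap (lact V) _ (bwd _))).
by rewrite -bmap_l bwdK bmap1 comp1m bwdK compm1.
Qed.

Definition commuting_sym (C E : Monoidal) (M : Category) (V : LeftModule C M)
    (W : LeftModule E M) (X : Commuting V W) : Commuting W V :=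
  @Build_Commuting E C M W V (fun e c m => iso_sym (swap X c e m))
    (fun e e' c c' m m' g f h => swap_nat_bwd X f g h)
    (fun x y c m => swap_r X c x y m) (fun e x y m => swap_l X x y e m).

Section CommutingFunctors.
Context (C E : Monoidal) (M : Category) (V : LeftModule C M) (W : LeftModule E M).
Context (X : Commuting V W) (KE : E) (rE : Representation KE).
Context (Q : ParAction rE (lact W)).

Definition swap_functor (e : E) : LaxFunctor V V.
Proof.
refine (@Build_LaxFunctor C M M V V (bfun_l (lact W) e)
  (fun c m => bwd (swap X c e m)) _ _).
- by move=> c c' m m' k h; exact: swap_nat_bwd.
- by move=> x y m; exact: swap_l.
Defined.

(** The bimodule distributor. It is the conjugate, for the action of [E], of the
    functor [c ▷ -], and it is also a lax structure on [e ▶ -] for the action of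
    [C] ([swap_par_functor]). *)
Definition swap_par (c : C) (e : E) (m : M) :
  Hom (lact V c (Q e m)) (Q e (lact V c m)) :=
  pcur Q (bmap (lact V) (idm c) (pev Q e m) ∘ fwd (swap X c _ _)).

Lemma transp_swap_par (c : C) (e : E) (m n : M) (k : Hom n (Q e m)) :
  transp (swap_par c e m ∘ bmap (lact V) (idm c) k) =
  bmap (lact V) (idm c) (transp k) ∘ fwd (swap X c _ n).
Proof.
rewrite transp_comp transp_cur -compA swap_nat compA -bmap_l.
by rewrite transpE.
Qed.

Lemma swap_par_nat (c c' : C) (e e' : E) (m m' : M) (f : Hom c c') (g : Hom e e')
    (h : Hom m m') :
  swap_par c' e' m' ∘ bmap (lact V) f (bmap Q g h) =
  bmap Q g (bmap (lact V) f h) ∘ swap_par c e m.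
Proof.
apply: transp_inj; rewrite transp_map transp_comp !transp_cur -!compA swap_nat.
rewrite (compA _ (bmap (lact V) _ _)) -bmapM comp1m pev_nat.
rewrite -(bmap1 (lact V) c (Q e m)) swap_nat (compA (bmap _ (idm c) (pev _ _ _))).
rewrite -bmap_l compA -bmapM compm1 compA.
by [].
Qed.

(** Transposing along the action of [E] reduces this to [swap_l]. *)
Lemma swap_par_assoc (x y : C) (e : E) (m : M) :
  bmap Q (idm e) (bwd (lassoc V x y m)) ∘ swap_par x e (lact V y m)
    ∘ bmap (lact V) (idm x) (swap_par y e m) =
  swap_par (x ⊗ y) e m ∘ bwd (lassoc V x y (Q e m)).
Proof.
apply: transp_inj; rewrite -compA transp_post transp_swap_par transp_comp !transp_cur.
rewrite bmap_l -!compA !(compA (bwd _)) lassoc_nat_bwd bmap1 -!compA; congr (_ ∘ _).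
by rewrite swap_l_fwd.
Qed.

(** The functor [- ◀ d] of a bimodule, in its role as [- □3 a4]. *)
Definition swap_par_functor (e : E) : LaxFunctor V V.
Proof.
refine (@Build_LaxFunctor C M M V V (bfun_l Q e) (fun c m => swap_par c e m) _ _).
- by move=> c c' m m' k h; exact: swap_par_nat.
- by move=> x y m; exact: swap_par_assoc.
Defined.

Lemma transp_conj_swap_par (KC : C) (rC : Representation KC)
    (P : ParAction rC (lact V)) (c : C) (e : E) (m : M) :
  transp (transp (oplax_conj P P (swap_par_functor e) c m)) =
  pev P c m ∘ bmap (lact V) (idm _) (pev Q e (P c m)) ∘ fwd (swap X _ _ _).
Proof. by rewrite transp_cur /= transp_post transp_cur compA. Qed.

(** Transposed in both directions, [e ▶ (c ▶ m) -> c ▶ (e ▶ m)] is the two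
    evaluations after [swap]. The condition determines it, hence identifies the
    bimodule constraint of ▶ and ◀, which is defined as a mate of [swap]. *)
Lemma conj_swap_par_unique (KC : C) (rC : Representation KC)
    (P : ParAction rC (lact V)) (c : C) (e : E) (m : M)
    (a : Hom (Q e (P c m)) (P c (Q e m))) :
  transp (transp a) =
  pev P c m ∘ bmap (lact V) (idm _) (pev Q e (P c m)) ∘ fwd (swap X _ _ _) ->
  a = oplax_conj P P (swap_par_functor e) c m.
Proof. by rewrite -transp_conj_swap_par => H; do 2! apply: transp_inj. Qed.

End CommutingFunctors.

(** * Pentagons of edges *)

Section EdgePentagons.
Context (C : Monoidal) (K : C) (r : Representation K) (R : ParAction r (tensor C)).

Definition box (A B X : Category) (T P : Bifunctor A B X) (o : oper) :
  Bifunctor A B X := match o with tens => T | parr => P end.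

Section ModuleEdges.
Context (M : Category) (V : LeftModule C M) (P : ParAction r (lact V)).

Definition module_edges :=
  forall (o o' : oper) (x y : C) (m : M),
    edge o o' (box (lact V) P o' (box (tensor C) R o x y) m)
      (box (lact V) P o x (box (lact V) P o' y m)).

Record canonical_edges (e : module_edges) : Prop := {
  edge_tt : forall x y m, e tens tens x y m = lassoc V x y m;
  edge_pp : forall x y m, fwd (e parr parr x y m) = par_par R P x y m;
  edge_pt : forall x y m, e parr tens x y m = par_tens R P x y m;
  edge_tp : forall x y m, e tens parr x y m = tens_par P x y m }.

End ModuleEdges.

Context (N M : Category) (U : LeftModule C N) (V : LeftModule C M).
Context (Q : ParAction r (lact U)) (P : ParAction r (lact V)).

Definition functor_edges (F : LaxFunctor U V) (o' : oper) :=
  forall (o : oper) (c : C) (n : N),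
    edge o o' (F (box (lact U) Q o c n)) (box (lact V) P o c (F n)).

(** When [□3 = ⊗], the edge of ▷ is invertible and the lax structure is its
    inverse; when [□3 = ⊙], the edge of ▶ is invertible and the conjugate points
    forward. *)
Definition lax_edges (F : LaxFunctor U V) (o' : oper) :
  functor_edges F o' -> Prop :=
  match o' return functor_edges F o' -> Prop with
  | tens => fun e => (forall c n, bwd (e tens c n) = lax_map F c n) /\
                     (forall c n, e parr c n = oplax_conj Q P F c n)
  | parr => fun e => (forall c n, e tens c n = lax_map F c n) /\
                     (forall c n, fwd (e parr c n) = oplax_conj Q P F c n)
  end.

(** All cases come from four equations about [F]; the case distinction only moves
    invertible edges to the side where [pentagon] puts them. *)
Lemma lax_pentagon (F : LaxFunctor U V) (o1 o2 o3 : oper)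
    (eN : module_edges Q) (eM : module_edges P) (eF : functor_edges F o3) :
  canonical_edges eN -> canonical_edges eM -> lax_edges eF ->
  forall (x y : C) (n : N),
  pentagon (edge_map F (eN o1 o2 x y n)) (eF o1 x (box (lact U) Q o2 y n))
    (edge_map (bfun_l (box (lact V) P o1) x) (eF o2 y n))
    (eF o2 (box (tensor C) R o1 x y) n) (eM o1 o2 x y (F n)).
Proof.
move=> [Ntt Npp Npt Ntp] [Mtt Mpp Mpt Mtp] HF x y n.
case: o3 eF HF => eF [Ft Fp]; case: o1; case: o2 => /=.
- rewrite Ntt Mtt -compA.
  (* Here all edges point forward, against the lax structure. *)
  pose i := iso_trans (iso_trans (fmap_iso F (lassoc U x y n)) (eF tens x (lact U y n)))
    (fmap_iso (bfun_l (lact V) x) (eF tens y n)).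
  pose j := iso_trans (eF tens (x ⊗ y) n) (lassoc V x y (F n)).
  apply: (@iso_inv_eq _ _ _ i j); rewrite /= !Ft.
  exact: lax_assoc.
- rewrite Ntp Mtp !Fp; apply: (iso_epic (i := iso_sym (eF tens x (Q y n)))) => /=.
  rewrite -!compA fwdK compm1 Ft -lax_tens_par.
  by rewrite compA.
- rewrite Npt Mpt Fp; apply: (iso_epic (i := iso_sym (eF tens (R x y) n))) => /=.
  rewrite -!compA fwdK compm1 Ft (compA (oplax_conj Q P F _ _)) lax_par_tens.
  rewrite -(Ft y n) compA -bmap_l fwdK bmap1.
  by rewrite comp1m.
- by rewrite Npp Mpp !Fp -compA lax_par_par.
- rewrite Ntt Mtt !Ft.
  exact: lax_assoc.
- rewrite Ntp Mtp Ft.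
  apply: (iso_monic (i := eF parr (x ⊗ y) n)).
  rewrite !compA fwdK comp1m !Fp lax_tens_par -compA -(Fp y n) -bmap_l fwdK bmap1.
  by rewrite compm1.
- rewrite Npt Mpt !Ft Fp.
  exact: lax_par_tens.
- by rewrite Npp Mpp !Fp -compA lax_par_par.
Qed.

End EdgePentagons.

Definition edge_rev (o o' : oper) (X : Category) (l r : X) :
  edge o o' l r -> edge o' o r l :=
  match o, o' return edge o o' l r -> edge o' o r l with
  | tens, tens | parr, parr => fun e => iso_sym e
  | parr, tens | tens, parr => fun e => e
  end.

(** Reading the four factors backwards exchanges [v1] with [v4] and [v2] with
    [v3], and reverses every edge; invertible edges are replaced by their
    inverses, and the two paths of the pentagon are kept. *)
Lemma pentagon_rev (o1 o2 o3 : oper) (X1 X3 Y : Category) (F1 : Functor X1 Y)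
    (F3 : Functor X3 Y) (a b : X1) (p q : X3) (v : Y) (e1 : edge o1 o2 a b)
    (e2 : edge o1 o3 (F1 b) (F3 p)) (e3 : edge o2 o3 p q)
    (e4 : edge o2 o3 (F1 a) v) (e5 : edge o1 o2 v (F3 q)) :
  pentagon (edge_map F3 (edge_rev e3)) (edge_rev e2) (edge_map F1 (edge_rev e1))
    (edge_rev e5) (edge_rev e4) ->
  pentagon (edge_map F1 e1) e2 (edge_map F3 e3) e4 e5.
Proof.
case: o1 e1 e2 e5; case: o2 e3 e4; case: o3 => /= e3 e4 e1 e2 e5 //.
- move=> E; rewrite -compA.
  apply: (@iso_inv_eq _ _ _
    (iso_trans (iso_trans (fmap_iso F1 e1) e2) (fmap_iso F3 e3)) (iso_trans e4 e5)).
  exact: E.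
- by move=> ->; rewrite -!compA bwdK compm1.
- by move=> E; rewrite -compA -E -!compA fwdKA.
- move=> E; rewrite -compA.
  apply: (@iso_inv_eq _ _ _
    (iso_trans (iso_trans (fmap_iso F1 e1) e2) (fmap_iso F3 e3)) (iso_trans e4 e5)).
  exact: E.
Qed.

(** * Left GV-module categories *)

Lemma counit_nat (A B : Category) (L : Functor A B) (R : Functor B A)
    (ad : Adjunction L R) (b b' : B) (h : Hom b b') :
  counit_of ad b' ∘ fmap L (fmap R h) = h ∘ counit_of ad b.
Proof. by rewrite -adj_fromE -[fmap R h]compm1 adj_from_natr. Qed.

Section LeftAction.
Context (C : GVCategory) (M : Category) (V : LeftModule C M) (gV : LeftGV V).

Definition left_action : ParAction (gv_rep C) (lact V).
Proof.
refine (@Build_ParAction C (gvK C) (gv_rep C) M (lact V) (lpar gV)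
  (fun c m => counit_of (radj_adj (lgv gV c)) m)
  (fun c m n g => adj (radj_adj (lgv gV c)) g) _ _ _).
- move=> c c' m m' f h.
  rewrite [LHS](_ : _ = counit_of (radj_adj (lgv gV c')) m' ∘
    fmap (bfun_l (lact V) (G c')) (lpar_map gV f h)); first by [].
  rewrite -adj_fromE /lpar_map /conjugate adj_from_natl bfromK /=.
  rewrite -compA bmap_swap compA; congr (_ ∘ _).
  exact: (counit_nat (radj_adj (lgv gV c))).
- move=> c m n g.
  rewrite [LHS](_ : _ = counit_of (radj_adj (lgv gV c)) m ∘
    fmap (bfun_l (lact V) (G c)) (adj (radj_adj (lgv gV c)) g)); first by [].
  by rewrite -adj_fromE bfromK.
- move=> c m n f f' E.
  rewrite -(btoK (adj (radj_adj (lgv gV c))) f) -(btoK (adj (radj_adj (lgv gV c))) f').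
  by rewrite !adj_fromE /= E.
Defined.

Lemma transp_left (c : C) (m n : M) (f : Hom n (left_action c m)) :
  transp f = bfrom (adj (radj_adj (lgv gV c))) f.
Proof. by rewrite transpE adj_fromE. Qed.

End LeftAction.

Section LeftConjugates.
Context (C : GVCategory) (N M : Category) (U : LeftModule C N) (V : LeftModule C M).
Context (gU : LeftGV U) (gV : LeftGV V) (F : LaxFunctor U V).

Lemma lconjE (c : C) (n : N) :
  lconj gU gV (lax_map F) c n = oplax_conj (left_action gU) (left_action gV) F c n.
Proof. exact: mateE. Qed.

Lemma lconj_inv_ext (g g' : forall (c : C) (m : N), Hom (F (lpar gU c m)) (lpar gV c (F m))) :
  (forall c m, g c m = g' c m) ->
  forall c m, lconj_inv g c m = lconj_inv g' c m.
Proof. by move=> E c m; rewrite /lconj_inv /unmate E. Qed.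

(** Conjugation is injective, so a distributor defined by [lconj_inv] is found by
    conjugating the expected answer. *)
Lemma lconj_inv_lax (c : C) (n : N) :
  lconj_inv (oplax_conj (left_action gU) (left_action gV) F) c n = lax_map F c n.
Proof.
rewrite -(lconjK gU gV (@lax_nat _ _ _ _ _ F)).
by apply: lconj_inv_ext => c' n'; rewrite lconjE.
Qed.

End LeftConjugates.

Section LeftRegular.
Context (C : GVCategory).

(** The same evaluations as the regular module has, but the action is [par]
    itself, as in the edges between objects of [C]. *)
Definition left_regular : ParAction (gv_rep C) (tensor C).
Proof.
refine (@Build_ParAction C (gvK C) (gv_rep C) C (tensor C) par
  (fun c z => counit_of (ladj c) z) (fun c z x g => lcur c x z g) _
  (pcurK (left_action (lregular_gv C))) (pcur_inj (p := left_action (lregular_gv C)))).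
move=> c c' z z' f h; rewrite -(bfromK (lcur c' _ z') (_ ∘ _)) -[RHS](bfromK (lcur c' _ z')).
congr (bfrom _ _).
have E (a b : C) : lcur a _ b (counit_of (ladj a) b) = idm (a ⊙ b) by exact: btoK.
rewrite lcur_natl lcur_natc (lcur_natr h) (E c z) (E c' z').
by rewrite comp1m compm1 -bmap_rl.
Defined.

Lemma formE (a z : C) (g : Hom a z) : form a z g = pairing (gv_rep C) z ∘ (idm _ ⊗m g).
Proof.
rewrite -{1}[g]comp1m form_natl; congr (_ ∘ _).
rewrite /= compm1 /pairing; congr (bfrom _ _).
exact: GGinv_tri_bwd.
Qed.

(** [form] is a bijection because [G] is an equivalence; compare [pairing_inj], which
    holds for any representation. *)
Lemma form_inj (a z : C) (g g' : Hom a z) :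
  pairing (gv_rep C) z ∘ (idm _ ⊗m g) = pairing (gv_rep C) z ∘ (idm _ ⊗m g') -> g = g'.
Proof. by rewrite -!formE => E; rewrite -(bfromK (form a z) g) E bfromK. Qed.

(** The adjunction behind ⊙ is a composite of representing bijections; it sends the
    evaluation to the identity, which makes its pairing that of [Gpar]. *)
Lemma dual_par_left (x y : C) : bwd (Gpar x y) = dual_par left_regular x y.
Proof.
apply: (@dual_par_unique _ _ _ left_regular x y (bwd (Gpar x y))); rewrite -formE pairingE.
have E : lcur x (x ⊙ y) y (pev left_regular x y) = idm (x ⊙ y) by exact: btoK.
rewrite -[RHS](bfromK (corep (G y ⊗ G x) (x ⊙ y))) -lcurE E /=.
by rewrite Gmap1 comp1m.
Qed.

(** Under [G] the associator of ⊙ is that of ⊗, as it is defined. *)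
Lemma Gmap_par_assoc (x y z : C) :
  Gmap (fwd (par_assoc x y z)) ∘ bwd (Gpar x (y ⊙ z)) ∘ (bwd (Gpar y z) ⊗m idm (G x)) =
  bwd (Gpar (x ⊙ y) z) ∘ (idm (G z) ⊗m bwd (Gpar x y)) ∘ fwd (massoc _ _ _).
Proof.
rewrite /= -!GinvmapM GGinv_nat_bwd -!compA -bmap_r fwdK bmap1 compm1.
by [].
Qed.

Lemma par_assoc_left (x y z : C) :
  fwd (par_assoc x y z) = par_par left_regular (V := lregular C) left_regular x y z.
Proof.
apply: (@par_par_dual _ _ _ left_regular x y z (fwd (par_assoc x y z))).
  by move=> w; exact: form_inj.
rewrite -!dual_par_left.
exact: Gmap_par_assoc.
Qed.

End LeftRegular.

Section LeftCanonical.
Context (C : GVCategory) (M : Category) (V : LeftModule C M) (gV : LeftGV V).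
Local Notation R := (left_regular C).
Local Notation P := (left_action gV).

Lemma ldist_par_tensE (x y : C) (m : M) :
  ldist_par_tens gV x y m = par_tens R P x y m.
Proof. exact: (lconjE (lregular_gv C) gV (tens_functor V m)). Qed.

Lemma lpar_assocE (x y : C) (m : M) :
  fwd (lpar_assoc gV x y m) = par_par R P x y m.
Proof.
apply: (par_par_unique (R := R) (P := P)).
rewrite !transp_left /= /conjugate /= !bfromK /= act_viaE -dual_par_left.
by [].
Qed.

Lemma ldist_tens_parE (x y : C) (m : M) :
  ldist_tens_par gV x y m = tens_par P x y m.
Proof.
rewrite -[RHS](lconj_inv_lax (lregular_gv C) gV (par_functor P m)).
by apply: (lconj_inv_ext (F := par_functor P m)) => c z; exact: lpar_assocE.
Qed.

End LeftCanonical.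

Lemma edge_CCM_canonical (C D : GVCategory) (M : Category) (V : GVBimodule C D M) :
  canonical_edges (R := left_regular C) (P := left_action (gvb_l V)) (edge_CCM V).
Proof.
split=> x y m //=.
- exact: lpar_assocE.
- exact: ldist_par_tensE.
- exact: ldist_tens_parE.
Qed.

Lemma edge_CCC_canonical (C : GVCategory) :
  canonical_edges (R := left_regular C) (V := lregular C) (P := left_regular C)
    (@edge_CCC C).
Proof.
split=> x y m //=.
- exact: par_assoc_left.
- exact: (ldist_par_tensE (lregular_gv C)).
- exact: (ldist_tens_parE (lregular_gv C)).
Qed.

Lemma pentagon_CCCM_commutes (C D : GVCategory) (M : Category) (V : GVBimodule C D M)
    (o1 o2 o3 : oper) (x y z : C) (m : M) : pentagon_CCCM V o1 o2 o3 x y z m.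
Proof.
have EC := edge_CCC_canonical C; have EM := edge_CCM_canonical V.
case: o3.
- pose e : functor_edges (U := lregular C) (left_regular C) (left_action (gvb_l V))
    (tens_functor (bimod_l V) m) tens := fun o c n => edge_CCM V o tens c n m.
  have H : lax_edges e by split=> c n //=; exact: ldist_par_tensE.
  exact: (lax_pentagon o1 o2 EC EM H x y z).
- pose e : functor_edges (U := lregular C) (left_regular C) (left_action (gvb_l V))
    (par_functor (left_action (gvb_l V)) m) parr := fun o c n => edge_CCM V o parr c n m.
  have H : lax_edges e by split=> c n /=; [exact: ldist_tens_parE | exact: lpar_assocE].
  exact: (lax_pentagon o1 o2 EC EM H x y z).
Qed.

(** * Reversed monoidal categories *)

Definition flip (A B X : Category) (T : Bifunctor A B X) : Bifunctor B A X :=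
  @Build_Bifunctor B A X (fun b a => T a b) (fun b b' a a' g f => bmap T f g)
    (fun b a => bmap1 T a b) (fun b b' b'' a a' a'' k h g f => bmapM T g f k h).

Definition rev (D : Monoidal) : Monoidal.
Proof.
refine (@Build_Monoidal D (flip (tensor D)) (munit D)
  (fun x y z => iso_sym (massoc z y x)) _
  (fun x => mrunit x) (fun x x' f => mrunit_nat f)
  (fun x => mlunit x) (fun x x' f => mlunit_nat f) _ _).
- by move=> *; exact: massoc_nat_bwd.
- by move=> x y z w; rewrite /= mpentagon_bwd.
- move=> x y /=.
  by rewrite -mtriangle -compA fwdK compm1.
Defined.

Lemma rpentagon_bwd (D : Monoidal) (M : Category) (V : RightModule D M) (m : M)
    (u v w : D) :
  bmap (ract V) (bwd (rassoc V m u v)) (idm w) ∘ bwd (rassoc V m (u ⊗ v) w)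
    ∘ bmap (ract V) (idm m) (bwd (massoc u v w)) =
  bwd (rassoc V (ract V m u) v w) ∘ bwd (rassoc V m u (v ⊗ w)).
Proof.
apply: (iso_epic (i := rassoc V m u (v ⊗ w))); rewrite -!compA bwdK compm1.
apply: (iso_epic (i := rassoc V (ract V m u) v w)); rewrite bwdK -!compA -rpentagon.
rewrite !compA -!(compA (bmap _ _ _ ∘ bwd _)) -bmap_l bwdK bmap1 comp1m.
by rewrite -!compA bwdKA -bmap_r bwdK bmap1.
Qed.

Definition rev_module (D : Monoidal) (M : Category) (V : RightModule D M) :
  LeftModule (rev D) M.
Proof.
refine (@Build_LeftModule (rev D) M (flip (ract V))
  (fun x y m => iso_sym (rassoc V m y x)) _
  (runit V) (fun m m' h => runit_nat V h) _ _).
- move=> x x' y y' m m' f g h /=.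
  apply: (iso_epic (i := rassoc V m y x)); rewrite -!compA bwdK compm1 -rassoc_nat.
  by rewrite bwdKA.
- by move=> x y z m; exact: rpentagon_bwd.
- move=> x m /=.
  by rewrite -rtriangle -compA fwdK compm1.
Defined.

(** In the reversed category the dual is [Ginv]: maps [x ⊗ y -> K] are maps
    [y -> Ginv x]. *)
Definition rev_rep (D : GVCategory) : Representation (gvK D : rev D) :=
  @Build_Representation (rev D) (gvK D) (@Ginv D) (fun x y => corep y x)
    (fun x x' y h f => corep_nat h f).

Lemma rev_dual_map (D : GVCategory) (y y' : D) (f : Hom y y') :
  dual_map (rev_rep D) f = Ginvmap f.
Proof.
transitivity (Ginvmap f ∘ corep y' _ (bfrom (corep y' _) (idm (Ginv y')))).
  exact: corep_natr.
by rewrite btoK compm1.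
Qed.

(** * Right GV-module categories *)

Section RightAction.
Context (D : GVCategory) (M : Category) (V : RightModule D M) (gV : RightGV V).

Definition right_action : ParAction (rev_rep D) (lact (rev_module V)).
Proof.
refine (@Build_ParAction (rev D) (gvK D) (rev_rep D) M (lact (rev_module V))
  (flip (rpar gV))
  (fun d m => counit_of (radj_adj (rgv gV d)) m)
  (fun d m n g => adj (radj_adj (rgv gV d)) g) _ _ _).
- move=> d d' m m' f h; rewrite rev_dual_map.
  rewrite [LHS](_ : _ = counit_of (radj_adj (rgv gV d')) m' ∘
    fmap (bfun_r (ract V) (Ginv d')) (rpar_map gV h f)); first by [].
  rewrite -adj_fromE /rpar_map /conjugate adj_from_natl bfromK /=.
  rewrite -compA -bmap_swap compA; congr (_ ∘ _).
  exact: (counit_nat (radj_adj (rgv gV d))).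
- move=> d m n g.
  rewrite [LHS](_ : _ = counit_of (radj_adj (rgv gV d)) m ∘
    fmap (bfun_r (ract V) (Ginv d)) (adj (radj_adj (rgv gV d)) g)); first by [].
  by rewrite -adj_fromE bfromK.
- move=> d m n f f' E.
  rewrite -(btoK (adj (radj_adj (rgv gV d))) f) -(btoK (adj (radj_adj (rgv gV d))) f').
  by rewrite !adj_fromE; congr (_ _).
Defined.

Lemma transp_right (d : D) (m n : M) (f : Hom n (right_action d m)) :
  transp f = bfrom (adj (radj_adj (rgv gV d))) f.
Proof. by rewrite transpE adj_fromE. Qed.

End RightAction.

(** * The left and right evaluations of ⊙ *)

Section RightRegular.
Context (D : GVCategory).
Implicit Types u v w m x y z d : D.

Lemma rcur_natd (d d' x z : D) (f : Hom d d') (g : Hom (x ⊗ Ginv d) z) :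
  rcur d' x z (g ∘ (idm x ⊗m Ginvmap f)) = bmap par (idm z) f ∘ rcur d x z g.
Proof.
rewrite !rcurE form_natl -compA -massoc_nat bmap1 compA rep_dual_map.
by rewrite -(lcur_natr f) !compA GGinv_nat.
Qed.

Definition right_regular : ParAction (rev_rep D) (tensor (rev D)).
Proof.
refine (@Build_ParAction (rev D) (gvK D) (rev_rep D) D (tensor (rev D)) (flip par)
  (fun d z => counit_of (radj_par d) z) (fun d z x g => rcur d x z g) _
  (pcurK (right_action (rregular_gv D))) (pcur_inj (p := right_action (rregular_gv D)))).
move=> d d' z z' f h; rewrite rev_dual_map.
rewrite -(bfromK (rcur d' _ z') (_ ∘ _)) -[RHS](bfromK (rcur d' _ z')).
congr (bfrom _ _).
have E (a b : D) : rcur a _ b (counit_of (radj_par a) b) = idm (b ⊙ a) by exact: btoK.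
rewrite rcur_natl rcur_natd (rcur_natr h) (E d z) (E d' z').
by rewrite comp1m compm1; exact: (bmap_lr par).
Defined.

Local Notation L := (left_regular D).
Local Notation κ := (pairing (gv_rep D)).

Definition copairing y : Hom (y ⊗ Ginv y) (gvK D) :=
  bfrom (corep y (Ginv y)) (idm (Ginv y)).
Local Notation κ' := copairing.

(** The left and right evaluations of ⊙, locked to survive rewriting. *)
Definition evl x y : Hom (G x ⊗ (x ⊙ y)) y := locked (pev L x y).
Definition evr x y : Hom ((x ⊙ y) ⊗ Ginv y) x :=
  locked (pev right_regular y x).

Lemma evlE x y : evl x y = bfrom (lcur x (x ⊙ y) y) (idm (x ⊙ y)).
Proof. by rewrite /evl -lock. Qed.

Lemma evrE x y : evr x y = bfrom (rcur y (x ⊙ y) x) (idm (x ⊙ y)).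
Proof. by rewrite /evr -lock. Qed.

Lemma pairing_rev x y (g : Hom x y) :
  κ' y ∘ (g ⊗m idm (Ginv y)) = bfrom (rep (gv_rep D)) (bwd (GGinv y) ∘ g).
Proof.
rewrite -(GGinv_nat_bwd g).
transitivity (bfrom (corep x _) (Ginvmap g ∘ idm (Ginv y))).
  by rewrite corep_from_natr.
by rewrite /= compm1.
Qed.

(** The two evaluations [G x ⊗ (x ⊙ y) ⊗ Ginv y -> K], which contract [x ⊙ y] with
    either neighbour first, agree. This is how the right adjunction of ⊙ is built
    from the left one, and everything on the right side follows from it. *)
Lemma pairing_evr x y :
  κ x ∘ (idm _ ⊗m evr x y) = κ' y ∘ (evl x y ⊗m idm _) ∘ bwd (massoc _ _ _).
Proof.
apply: (iso_epic (i := massoc _ _ _)); rewrite -[RHS]compA bwdK compm1.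
rewrite -formE pairing_rev -[LHS](bfromK (rep (gv_rep D))).
congr (bfrom _ _); apply: (iso_monic (i := GGinv y)); rewrite fwdKA.
rewrite -[LHS](bfromK (lcur x _ y)) -rcurE.
by rewrite evrE btoK evlE.
Qed.

Lemma pairing_evr_map x y a b (p : Hom a (x ⊙ y)) (q : Hom b (Ginv y)) :
  κ x ∘ (idm _ ⊗m (evr x y ∘ (p ⊗m q))) =
  κ' y ∘ ((evl x y ∘ (idm _ ⊗m p)) ⊗m q) ∘ bwd (massoc _ _ _).
Proof.
rewrite bmap_l compA pairing_evr -!compA massoc_nat_bwd (compA (evl x y ⊗m _)).
by rewrite -bmapM comp1m.
Qed.

(** [Ginvpar] is obtained from the Yoneda lemma by inserting the right evaluation
    into the pairing of [x], and this is the property that defines [dual_par]. *)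
Lemma dual_par_right x y :
  bwd (Ginvpar x y) = @dual_par _ _ _ right_regular y x.
Proof.
apply: (@dual_par_unique _ _ _ right_regular y x (bwd (Ginvpar x y))).
rewrite pairingE.
transitivity (bfrom (rep (gv_rep D)) (bwd (par_G x y))).
  rewrite -[RHS](bfromK (corep (x ⊙ y) _)); congr (bfrom _ _).
  by rewrite [RHS]/= /corep_fun btoK.
have E : κ' x ∘ (evr x y ⊗m idm (Ginv x)) ∘ bwd (massoc _ _ _) =
  bfrom (rep (gv_rep D)) (bwd (par_G x y)).
  by rewrite pairing_rev evrE /= bfromK.
by rewrite -E evrE.
Qed.

(** [par_assoc_left] read as an exchange of evaluations; [evl_evr] and [evr_evr]
    carry it over to the right side. *)
Lemma evl_evl x y z :
  evl y z ∘ (idm (G y) ⊗m evl x (y ⊙ z)) =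
  evl (x ⊙ y) z ∘ (bwd (Gpar x y) ⊗m bwd (par_assoc x y z)) ∘ bwd (massoc _ _ _).
Proof.
have := transp_par_par L (V := lregular D) L x y z.
rewrite -par_assoc_left !transpE act_viaE -dual_par_left => E.
have {}E : evl y z ∘ (idm (G y) ⊗m (evl x (y ⊙ z) ∘ (idm (G x) ⊗m fwd (par_assoc x y z)))) =
    evl (x ⊙ y) z ∘ ((bwd (Gpar x y) ⊗m idm _) ∘ bwd (massoc _ _ _)).
  by rewrite !evlE; exact: E.
transitivity (evl y z ∘ (idm _ ⊗m (evl x (y ⊙ z) ∘ (idm _ ⊗m fwd (par_assoc x y z))))
    ∘ (idm _ ⊗m (idm _ ⊗m bwd (par_assoc x y z)))).
  by rewrite -compA -bmap_l -compA -bmap_l fwdK bmap1 compm1.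
rewrite E -!compA massoc_nat_bwd bmap1 (compA (_ ⊗m idm _)) -bmapM.
by rewrite comp1m compm1.
Qed.

Lemma pairing_evl x y :
  κ y ∘ (idm _ ⊗m evl x y) =
  κ (x ⊙ y) ∘ ((bwd (Gpar x y) ⊗m idm _) ∘ bwd (massoc _ _ _)).
Proof. by rewrite evlE dual_par_left; exact: (pairing_pev L). Qed.

(** The associator exchanges a left and a right evaluation of [x ⊙ y ⊙ z]. Pairing
    with [y] turns the right evaluations into left ones, where [evl_evl] applies. *)
Lemma evl_evr x y z :
  evr y z ∘ (evl x (y ⊙ z) ⊗m idm (Ginv z)) ∘ bwd (massoc _ _ _) =
  evl x y ∘ (idm (G x) ⊗m (evr (x ⊙ y) z ∘ (bwd (par_assoc x y z) ⊗m idm _))).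
Proof.
apply: form_inj; rewrite bmap_l !compA pairing_evr_map evl_evl.
rewrite [in RHS]bmap_l compA pairing_evl -!compA massoc_nat_bwd bmap1.
move: (bwd (par_assoc x y z)) => b.
rewrite (compA (bwd (Gpar x y) ⊗m _)) -bmapM comp1m compm1 [bwd (Gpar x y) ⊗m (_ ∘ _)]bmap_lr.
rewrite !compA pairing_evr_map bmap_r.
rewrite -!compA (compA (bwd (massoc _ _ _) ⊗m _)) mpentagon_bwd.
rewrite -(bmap1 (tensor D) (x ⊙ y ⊙ z)) (compA (bwd _) (_ ⊗m _)) massoc_nat_bwd -!compA.
rewrite (compA (_ ⊗m idm (Ginv z)) (_ ⊗m idm (Ginv z))) -bmap_r -compA -bmapM.
by rewrite comp1m compm1.
Qed.

Lemma copairing_evr x y :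
  κ' x ∘ (evr x y ⊗m idm (Ginv x)) =
  κ' (x ⊙ y) ∘ (idm _ ⊗m bwd (Ginvpar x y)) ∘ fwd (massoc _ _ _).
Proof.
have := @pairing_par _ _ _ right_regular y x; rewrite -dual_par_right => E.
have {}E : κ' (x ⊙ y) ∘ (idm _ ⊗m bwd (Ginvpar x y)) =
  κ' x ∘ (evr x y ⊗m idm (Ginv x)) ∘ bwd (massoc _ _ _) by rewrite evrE; exact: E.
by rewrite E -compA bwdK compm1.
Qed.

(** Pairing with [x] turns the right evaluations that end in [x] into left ones and
    leaves [evl_evr]. *)
Lemma evr_evr x y z :
  evr x y ∘ ((evr (x ⊙ y) z ∘ (bwd (par_assoc x y z) ⊗m idm _)) ⊗m idm (Ginv y)) =
  evr x (y ⊙ z) ∘ (idm _ ⊗m bwd (Ginvpar y z)) ∘ fwd (massoc _ _ _).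
Proof.
apply: form_inj; rewrite pairing_evr_map -evl_evr.
rewrite bmap_l compA pairing_evr_map bmap1 compm1.
rewrite bmap_r compA bmap_r compA copairing_evr.
rewrite -!compA (compA (fwd _) (_ ⊗m idm (Ginv y))) massoc_nat bmap1 -!compA.
rewrite (compA (_ ⊗m bwd _)) -bmapM comp1m compm1; congr (_ ∘ (_ ∘ _)).
(* What remains is an instance of the pentagon of ⊗. *)
apply: (iso_epic (i := fmap_iso (bfun_l (tensor D) (G x))
  (iso_sym (massoc (x ⊙ y ⊙ z) (Ginv z) (Ginv y))))) => /=.
rewrite -!compA -bmap_l fwdK bmap1 compm1 (compA (bwd _ ⊗m _)) mpentagon_bwd.
by rewrite fwdKA.
Qed.

Lemma par_assoc_right x y z :
  bwd (par_assoc x y z) =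
  par_par right_regular (V := lregular (rev D)) right_regular z y x.
Proof.
apply: (@par_par_unique _ _ _ right_regular D (lregular (rev D)) right_regular z y x
  (bwd (par_assoc x y z))).
rewrite !transpE act_viaE -dual_par_right.
by have := evr_evr x y z; rewrite !evrE -compA.
Qed.

End RightRegular.

(** * The distributors of right modules *)

Section RightConjugates.
Context (D : GVCategory) (N M : Category) (U : RightModule D N) (V : RightModule D M).
Context (gU : RightGV U) (gV : RightGV V) (F : Functor N M).
Context (f : forall (n : N) (d : D), Hom (ract V (F n) d) (F (ract U n d))).

(** [oplax_conj] for a functor whose source is given as a right module, so that
    the regular right module needs no conversion to a left module over [rev D]. *)
Definition right_conj (n : N) (d : D) : Hom (F (rpar gU n d)) (rpar gV (F n) d) :=
  pcur (right_action gV)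
    (fmap F (pev (right_action gU) d n) ∘ f (rpar gU n d) (Ginv d)).

Lemma rconjE (n : N) (d : D) : rconj gU gV f n d = right_conj n d.
Proof. exact: mateE. Qed.

Lemma rconj_inv_lax (g : forall (m : N) (d : D), Hom (F (rpar gU m d)) (rpar gV (F m) d)) :
  (forall m m' d d' (h : Hom m m') (k : Hom d d'),
    f m' d' ∘ bmap (ract V) (fmap F h) k = fmap F (bmap (ract U) h k) ∘ f m d) ->
  (forall m d, g m d = right_conj m d) ->
  forall n d, rconj_inv g n d = f n d.
Proof.
move=> f_nat E n d; rewrite -(rconjK gU gV f_nat).
by rewrite /rconj_inv /unmate E -rconjE.
Qed.

End RightConjugates.

Section RightCanonical.
Context (D : GVCategory) (M : Category) (V : RightModule D M) (gV : RightGV V).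
Local Notation R := (right_regular D).
Local Notation P := (right_action gV).

Lemma rdist_tens_parE (m : M) (u v : D) :
  rdist_tens_par gV m u v = par_tens R P v u m.
Proof. exact: (rconjE (rregular_gv D) gV (F := bfun_l (ract V) m)). Qed.

Lemma rpar_assocE (m : M) (u v : D) :
  bwd (rpar_assoc gV m u v) = par_par R P v u m.
Proof.
apply: (par_par_unique (R := R) (P := P)).
rewrite !transp_right /= /conjugate /= !bfromK /= act_viaE -dual_par_right.
by [].
Qed.

Lemma rdist_par_tensE (m : M) (u v : D) :
  rdist_par_tens gV m u v = tens_par P v u m.
Proof.
apply: (rconj_inv_lax (gU := rregular_gv D) (gV := gV) (F := bfun_l (rpar gV) m)
  (f := fun w d => tens_par P d w m)).
- by move=> w w' d d' h k; exact: (tens_par_nat P k h (idm m)).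
- by move=> w d; exact: rpar_assocE.
Qed.

End RightCanonical.

(** The reversed type of an edge agrees with the type demanded here only once the
    two operations are known, hence the case distinction. *)
Definition edge_DDM (C D : GVCategory) (M : Category) (V : GVBimodule C D M) :
  module_edges (right_regular D) (right_action (gvb_r V)).
Proof.
move=> o o' x y m; move: (edge_rev (edge_MDD V o' o m y x)).
by case: o; case: o' => e; exact: e.
Defined.

Lemma edge_DDM_canonical (C D : GVCategory) (M : Category) (V : GVBimodule C D M) :
  canonical_edges (edge_DDM V).
Proof.
split=> x y m //=.
- exact: rpar_assocE.
- exact: rdist_tens_parE.
- exact: rdist_par_tensE.
Qed.

Definition edge_DDD_rev (D : GVCategory) :
  module_edges (V := lregular (rev D)) (right_regular D) (right_regular D).
Proof.
move=> o o' x y z; move: (edge_rev (@edge_DDD D o' o z y x)).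
by case: o; case: o' => e; exact: e.
Defined.

Lemma edge_DDD_canonical (D : GVCategory) : canonical_edges (@edge_DDD_rev D).
Proof.
split=> x y m //=.
- exact: par_assoc_right.
- exact: (rdist_tens_parE (rregular_gv D)).
- exact: (rdist_par_tensE (rregular_gv D)).
Qed.

Lemma pentagon_MDDD_commutes (C D : GVCategory) (M : Category) (V : GVBimodule C D M)
    (o1 o2 o3 : oper) (m : M) (u v w : D) : pentagon_MDDD V o1 o2 o3 m u v w.
Proof.
have ED := edge_DDD_canonical D; have EM := edge_DDM_canonical V.
apply: (pentagon_rev (F1 := bfun_r (rbox V o3) w) (F3 := bfun_l (rbox V o1) m)
  (e1 := edge_MDD V o1 o2 m u v) (e2 := edge_MDD V o1 o3 m (cbox D o2 u v) w)
  (e3 := edge_DDD o2 o3 u v w)).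
case: o1.
- pose e : functor_edges (U := lregular (rev D)) (right_regular D) (right_action (gvb_r V))
    (tens_functor (rev_module (bimod_r V)) m) tens :=
    fun o c n => match o with
      | tens => edge_rev (edge_MDD V tens tens m n c)
      | parr => edge_rev (edge_MDD V tens parr m n c) end.
  have H : lax_edges e by split=> c n //=; exact: rdist_tens_parE.
  have := lax_pentagon o3 o2 ED EM H w v u.
  by case: o2; case: o3.
- pose e : functor_edges (U := lregular (rev D)) (right_regular D) (right_action (gvb_r V))
    (par_functor (right_action (gvb_r V)) m) parr :=
    fun o c n => match o with
      | tens => edge_rev (edge_MDD V parr tens m n c)
      | parr => edge_rev (edge_MDD V parr parr m n c) end.
  have H : lax_edges e.
    by split=> c n /=; [exact: rdist_par_tensE | exact: rpar_assocE].
  have := lax_pentagon o3 o2 ED EM H w v u.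
  by case: o2; case: o3.
Qed.

(** * Bimodules *)

(** The bimodule constraint moves the right factor inwards; for [rev D] acting from
    the left this is [swap]. *)
Definition bimodule_commuting (C D : Monoidal) (M : Category) (V : Bimodule C D M) :
  Commuting (bimod_l V) (rev_module (bimod_r V)).
Proof.
refine (@Build_Commuting C (rev D) M (bimod_l V) (rev_module (bimod_r V))
  (fun c d m => bassoc V c m d) _ _ _).
- by move=> *; exact: bassoc_nat.
- move=> x y d m.
  pose i := iso_trans (iso_trans (fmap_iso (bfun_r (ract (bimod_r V)) d) (lassoc (bimod_l V) x y m))
    (bassoc V x (lact (bimod_l V) y m) d
     : Iso (bfun_r (ract (bimod_r V)) d (lact (bimod_l V) x (lact (bimod_l V) y m))) _))
    (fmap_iso (bfun_l (lact (bimod_l V)) x) (bassoc V y m d)).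
  pose j := iso_trans (bassoc V (x ⊗ y) m d) (lassoc (bimod_l V) x y (ract (bimod_r V) m d)).
  apply: (@iso_inv_eq _ _ _ (iso_sym i) (iso_sym j)).
  by rewrite /= compA bpentagon_l.
- by move=> c x y m; rewrite /= bpentagon_r.
Defined.

Section BimoduleCanonical.
Context (C D : GVCategory) (M : Category) (V : GVBimodule C D M).
Local Notation X := (bimodule_commuting V).
Local Notation P := (left_action (gvb_l V)).
Local Notation Q := (right_action (gvb_r V)).

Lemma bdist_tens_parE (c : C) (m : M) (d : D) :
  bdist_tens_par V c m d = swap_par X Q c d m.
Proof. exact: (rconjE (gvb_r V) (gvb_r V) (F := bfun_l (lact (bimod_l V)) c)). Qed.

Lemma bpar_assocE (c : C) (m : M) (d : D) :
  fwd (bpar_assoc V c m d) = oplax_conj P P (swap_par_functor X Q d) c m.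
Proof.
apply: (@conj_swap_par_unique _ _ _ _ _ X _ _ Q _ _ P).
rewrite transp_left transp_right /= /conjugate /= !bfromK.
congr (_ ∘ _); rewrite /counit_of /=.
exact: (adj_fromE (radj_adj (lgv (gvb_l V) c))).
Qed.

Lemma bpar_assoc_bwdE (c : C) (m : M) (d : D) :
  bwd (bpar_assoc V c m d) = oplax_conj Q Q (swap_par_functor (commuting_sym X) P c) d m.
Proof.
apply: (@conj_swap_par_unique _ _ _ _ _ (commuting_sym X) _ _ P _ _ Q).
rewrite transp_left transp_right /= /conjugate /= !bfromK.
congr (_ ∘ _); rewrite /counit_of /=.
exact: (adj_fromE (radj_adj (rgv (gvb_r V) d))).
Qed.

(** This distributor is defined by conjugation along the right action, from the
    constraint of ▶ and ◀. The conjugate of [swap_par], taken along the right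
    action, is that constraint ([bpar_assoc_bwdE]). *)
Lemma bdist_par_tensE (c : C) (m : M) (d : D) :
  bdist_par_tens V c m d = swap_par (commuting_sym X) P d c m.
Proof.
apply: (rconj_inv_lax (gU := gvb_r V) (gV := gvb_r V) (F := bfun_l (lpar (gvb_l V)) c)
  (f := fun n e => swap_par (commuting_sym X) P e c n)).
- by move=> n n' e e' h k; exact: (swap_par_nat (commuting_sym X) P k (idm c) h).
- by move=> n e; rewrite bpar_assoc_bwdE.
Qed.

Lemma pentagon_CCMD_commutes (o1 o2 o3 : oper) (x y : C) (m : M) (d : D) :
  pentagon_CCMD V o1 o2 o3 x y m d.
Proof.
have E := edge_CCM_canonical V.
case: o3.
- pose e : functor_edges P P (swap_functor X d) tens :=
    fun o c n => edge_CMD V o tens c n d.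
  have H : lax_edges e by split=> c n //=; exact: bdist_par_tensE.
  exact: (lax_pentagon o1 o2 E E H x y m).
- pose e : functor_edges P P (swap_par_functor X Q d) parr :=
    fun o c n => edge_CMD V o parr c n d.
  have H : lax_edges e by split=> c n /=; [exact: bdist_tens_parE | exact: bpar_assocE].
  exact: (lax_pentagon o1 o2 E E H x y m).
Qed.

(** Read backwards, [c □1 -] is the functor of right modules that plays the role of
    [- □3 a4]; □1 then decides between [swap] and [swap_par]. *)
Lemma pentagon_CMDD_commutes (o1 o2 o3 : oper) (c : C) (m : M) (u v : D) :
  pentagon_CMDD V o1 o2 o3 c m u v.
Proof.
have E := edge_DDM_canonical V.
apply: (pentagon_rev (F1 := bfun_r (rbox V o3) v) (F3 := bfun_l (lbox V o1) c)
  (e1 := edge_CMD V o1 o2 c m u) (e2 := edge_CMD V o1 o3 c (rbox V o2 m u) v)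
  (e3 := edge_MDD V o2 o3 m u v)).
case: o1.
- pose e : functor_edges Q Q (swap_functor (commuting_sym X) c) tens :=
    fun o d n => match o with
      | tens => edge_rev (edge_CMD V tens tens c n d)
      | parr => edge_rev (edge_CMD V tens parr c n d) end.
  have H : lax_edges e by split=> d n //=; exact: bdist_tens_parE.
  have := lax_pentagon o3 o2 E E H v u m.
  by case: o2; case: o3.
- pose e : functor_edges Q Q (swap_par_functor (commuting_sym X) P c) parr :=
    fun o d n => match o with
      | tens => edge_rev (edge_CMD V parr tens c n d)
      | parr => edge_rev (edge_CMD V parr parr c n d) end.
  have H : lax_edges e.
    by split=> d n /=; [exact: bdist_par_tensE | exact: bpar_assoc_bwdE].
  have := lax_pentagon o3 o2 E E H v u m.
  by case: o2; case: o3.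
Qed.

End BimoduleCanonical.

Theorem corollary3p32 (C D : GVCategory) (M : Category)
  (V : GVBimodule C D M) :
  (forall (o1 o2 o3 : oper) (m : M) (u v w : D),
     pentagon_MDDD V o1 o2 o3 m u v w) /\
  (forall (o1 o2 o3 : oper) (c : C) (m : M) (u v : D),
     pentagon_CMDD V o1 o2 o3 c m u v) /\
  (forall (o1 o2 o3 : oper) (x y : C) (m : M) (d : D),
     pentagon_CCMD V o1 o2 o3 x y m d) /\
  (forall (o1 o2 o3 : oper) (x y z : C) (m : M),
     pentagon_CCCM V o1 o2 o3 x y z m).
Proof.
split; first exact: pentagon_MDDD_commutes.
split; first exact: pentagon_CMDD_commutes.
split; first exact: pentagon_CCMD_commutes.
exact: pentagon_CCCM_commutes.
Qed.
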